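(* Let $\mathcal{H}$ be a nonzero complex Hilbert space, let $A,D\in\mathcal{B}(\mathcal{H})$, and let $f$ be a non-negative increasing operator convex function on $[0,\infty)$. Then $$f(\|AD^*\|)\le\left\|\int_0^1 f\left((1-t)\left(\frac{|A|^2+|D|^2}{2}\right)+t\|AD^*\|I\right)dt\right\|\le\left\|f\left(\frac{|A|^2+|D|^2}{2}\right)\right\|.$$
   Context: $\mathcal{B}(\mathcal{H})$ is the set of bounded linear operators on $\mathcal{H}$, $A^*$ is the adjoint of $A$, $|A|=(A^*A)^{1/2}$, $I$ is the identity operator, and $\|\cdot\|$ is the operator norm. A real-valued continuous function $f$ on an interval $J$ is operator convex if for all selfadjoint operators $S,T\in\mathcal{B}(\mathcal{H})$ with spectra contained in $J$ one has $f((1-t)S+tT)\le(1-t)f(S)+tf(T)$ for all $t\in[0,1]$, where $f$ of a selfadjoint operator is given by the continuous functional calculus and $\le$ is the usual order on selfadjoint operators. The integral is the integral over $[0,1]$ of a norm-continuous operator-valued function. *)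

(* Defs.v *)
From HB Require Import structures.
From mathcomp Require Import all_boot all_order all_algebra complex.
From mathcomp Require Import all_classical all_reals all_analysis.

Set Implicit Arguments.
Unset Strict Implicit.
Unset Printing Implicit Defensive.

Import Order.TTheory GRing.Theory Num.Theory.
Import numFieldNormedType.Exports.

Local Open Scope classical_set_scope.
Local Open Scope ring_scope.
Local Open Scope complex_scope.

(* A complex Hilbert space is a complete normed space over R[i] whose norm     *)
(* comes from an inner product, linear in its first argument (positivity is    *)
(* implied by inner_norm). The library's norm `|x| takes its values in R[i],   *)
(* hence the real part in opnorm.                                              *)
HB.mixin Record CompleteNormedModule_isHilbert (R : realType) H
    of CompleteNormedModule R[i] H := {
  inner : H -> H -> R[i] ;
  inner_linearl : forall (a : R[i]) (x y z : H),
    inner (a *: x + y) z = a * inner x z + inner y z ;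
  inner_conj : forall x y : H, inner x y = (inner y x)^* ;
  inner_norm : forall x : H, inner x x = `|x| ^+ 2
}.

#[short(type="hilbertType")]
HB.structure Definition Hilbert (R : realType) :=
  {H of CompleteNormedModule R[i] H & CompleteNormedModule_isHilbert R H}.

Section Operators.
Context {R : realType} {H : hilbertType R}.
Implicit Types (A B S T : H -> H) (f : R -> R).

Definition bounded_operator A : Prop :=
  linear A /\ exists M : R, forall x, `|A x| <= M%:C * `|x|.

Definition opnorm A : R :=
  sup [set complex.Re `|A x| | x in [set x | `|x| <= 1]].

Definition is_adjoint A B : Prop :=
  bounded_operator B /\ forall x y : H, inner (A x) y = inner x (B y).

(* Here and below, xget picks the unique such operator; the default 0 is only  *)
(* reached when there is none.                                                 *)
Definition adjoint A : H -> H := xget 0 [set B | is_adjoint A B].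

Definition selfadjoint A : Prop := bounded_operator A /\ adjoint A = A.

Definition op_le S T : Prop := forall x : H, 0 <= inner (T x - S x) x.

Definition spectrum A : set R[i] :=
  [set z | ~ exists B, [/\ bounded_operator B,
                           B \o (A - z *: idfun) = idfun
                         & (A - z *: idfun) \o B = idfun]].

Definition poly_op (p : {poly R}) A : H -> H :=
  \sum_(i < size p) (p`_i)%:C *: iter i A.

(* For A selfadjoint and f continuous on the spectrum of A, f(A) is the norm   *)
(* limit of p_n(A), for real polynomials p_n converging to f uniformly on the  *)
(* spectrum.                                                                   *)
Definition is_cfc f A T : Prop :=
  bounded_operator T /\
  forall e : R, 0 < e -> exists p : {poly R},
    (forall x : R, spectrum A x%:C -> `|p.[x] - f x| <= e) /\
    opnorm (poly_op p A - T) <= e.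

Definition cfc f A : H -> H := xget 0 [set T | is_cfc f A T].

Definition absop A : H -> H := cfc Num.sqrt (adjoint A \o A).

(* Operator convexity on J, tested on the operators of the given space H.      *)
Definition operator_convex (J : interval R) f : Prop :=
  {within [set` J], continuous f} /\
  forall S T, selfadjoint S -> selfadjoint T ->
    spectrum S `<=` [set x%:C | x in [set` J]] ->
    spectrum T `<=` [set x%:C | x in [set` J]] ->
    forall t : R, 0 <= t <= 1 ->
      op_le (cfc f ((1 - t)%:C *: S + t%:C *: T))
            ((1 - t)%:C *: cfc f S + t%:C *: cfc f T).

(* Sum of (s_i - s_(i-1)) F(xi_i), with s_0 = a.                               *)
Definition riemann_sum (a b : R) (F : R -> H -> H) (s : seq R) (xi : nat -> R)
    : H -> H :=
  \sum_(i < size s) (nth b (a :: s) i.+1 - nth b (a :: s) i)%:C *: F (xi i).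

(* T is the Riemann integral of F over [a, b], as a limit in operator norm.    *)
Definition is_op_integral (a b : R) (F : R -> H -> H) T : Prop :=
  bounded_operator T /\
  forall e : R, 0 < e -> exists d : R, 0 < d /\
    forall (s : seq R) (xi : nat -> R), itv_partition a b s ->
      (forall i, (i < size s)%N ->
         nth b (a :: s) i <= xi i <= nth b (a :: s) i.+1 /\
         nth b (a :: s) i.+1 - nth b (a :: s) i < d) ->
      opnorm (riemann_sum a b F s xi - T) <= e.

Definition op_integral (a b : R) (F : R -> H -> H) : H -> H :=
  xget 0 [set T | is_op_integral a b F T].

End Operators.

Arguments operator_convex {R} H J f.

(* Main.v *)
Require Import Defs.
From HB Require Import structures.
From mathcomp Require Import all_boot all_order all_algebra complex.
From mathcomp Require Import all_classical all_reals all_analysis.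
From mathcomp Require Import ring lra.

Set Implicit Arguments.
Unset Strict Implicit.
Unset Printing Implicit Defensive.

Import Order.TTheory GRing.Theory Num.Theory.
Import numFieldNormedType.Exports.

Local Open Scope classical_set_scope.
Local Open Scope ring_scope.
Local Open Scope complex_scope.

(* Write m = |X|. The positive operator X has spectrum in [0, m], with m an
   approximate eigenvalue, and a Bhatia-Kittaneh argument gives n <= m. By
   uniform approximation with polynomials, the operator integral is g(X), where
   g x is the integral over [0, 1] of f ((1 - t) x + t n). For continuous g, the
   norm of g(X) is at most the supremum of |g| on the spectrum and at least
   |g m|. As f is nonnegative and increasing, f n <= g m and g <= f m on [0, m],
   while |f(X)| >= f m.

   The functional calculus rests on the identity |p(A)| = |p r| for a real
   polynomial p, a symmetric A and some r in the spectrum of A. *)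

(** * Weierstrass approximation and means over segments *)

(** In infinite dimension a symmetric operator may have no eigenvectors, so norms are computed with
    approximate eigenvalues: they belong to the spectrum, hence bounds on the spectrum apply to
    them, and a polynomial p sends one of A to one of p(A), which gives lower bounds for norms. The
    number m is one of X itself because X is positive; in general only m or -m would be. The
    operators [adjoint], [cfc] and [op_integral] are picked by [xget], so each needs an existence
    proof: Riesz representation, Weierstrass polynomials with completeness, and Riemann sums. The
    integral also needs uniqueness, since it has to be the particular operator g(X). The final
    comparison is scalar: by the mean value theorem g x is the value of f at a point of the segment
    from x to n, and n <= m keeps that segment in [n, m] for x = m and in [0, m] for every x of the
    spectrum. Weierstrass is obtained by rescaling to [0, 1], which requires a nondegenerate
    interval; as m can be 0, the interval is enlarged to [0, m + 1]. *)

Section RealAnalysis.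
Context {R : realType}.
Implicit Types (h f : R -> R) (a b x y e d t : R).

Definition unif_cont_on a b h : Prop :=
  forall e, 0 < e -> exists2 d : R, 0 < d &
    forall x y, a <= x <= b -> a <= y <= b -> `|x - y| < d ->
      `|h x - h y| <= e.

(** Heine-Cantor, with compactness used as a near-covering property: a small radius that works
    around each point of the segment yields one radius that works for all of them. *)
Lemma continuous_unif_cont_on a b h : continuous h -> unif_cont_on a b h.
Proof.
move=> ch e e0.
pose P (d x : R) := forall y, `|x - y| < d -> `|h x - h y| <= e.
have H : forall x : R, `[a, b]%classic x ->
    \forall x' \near x & d \near (0:R)^'+, P d x'.
  move=> x _; have e2 : 0 < e / 2 by lra.
  have /cvgr_dist_le/(_ _ e2)/nbhs_ballP[r /= r0 hr] := ch x.
  exists (ball x (r / 2), [set d | 0 < d /\ d < r / 2]) => /=.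
    split; first by apply: nbhsx_ballx; rewrite divr_gt0.
    near=> d; split => //; near: d; apply: nbhs_right_lt; lra.
  move=> [x' d] /= [xx' [d0 dr]] y x'y.
  have h1 : `|h x - h x'| <= e / 2 by apply: hr; rewrite /ball/= in xx' *; lra.
  have h2 : `|h x - h y| <= e / 2.
    apply: hr; rewrite /ball_ /ball /= in xx' *.
    rewrite (_ : x - y = (x - x') + (x' - y)); last by ring.
    rewrite (le_lt_trans (ler_normD _ _))//; lra.
  rewrite (_ : h x' - h y = (h x - h y) - (h x - h x')); last by ring.
  rewrite (le_trans (ler_normB _ _))//; lra.
have /compact_near_coveringP/(_ R (0^'+) P _ H) := @segment_compact R a b.
move=> [r /= r0 hr].
exists (r / 2) => [|x y xab _ xy]; first by rewrite divr_gt0.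
apply: (hr (r / 2)) => //=; last by lra.
by rewrite sub0r normrN gtr0_norm; lra.
Unshelve. all: by end_near. Qed.

(** Extending [f] to the left of 0 by the constant [f 0] gives a function continuous on the whole
    line, to which the lemmas on global continuity apply. *)
Lemma continuous_comp_max0 f :
  {within `[0, +oo[, continuous f} -> continuous (fun x => f (Num.max 0 x)).
Proof.
move=> /subspace_continuousP cf x; apply/cvgrPdist_le => e e0.
have x0 : `[0, +oo[%classic (Num.max 0 x) by rewrite /= in_itv/= andbT le_max lexx.
have /cvgrPdist_le/(_ e e0) := cf _ x0; rewrite near_withinE => /nbhs_ballP[r /= r0 hr].
apply/nbhs_ballP; exists r => //= z; rewrite /ball/= => xz.
apply: hr; last by rewrite /= in_itv/= andbT le_max lexx.
rewrite /ball/=; apply: le_lt_trans xz.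
have h1 := ler_norm (x - z); have h2 := ler_norm (z - x); rewrite distrC in h2.
by rewrite ler_norml !maxEle; case: (leP 0 x); case: (leP 0 z) => *; apply/andP; split; lra.
Qed.

Lemma antiderivative h : continuous h ->
  exists F : R -> R, forall t, 0 <= t <= 1 -> is_derive t 1 F (h t).
Proof.
(* The base point -1, and the right end 2 below, make 0 and 1 interior points, so that the
   derivative is two-sided on all of [0, 1]. *)
move=> ch; exists (fun x => (\int[lebesgue_measure]_(t in `[-1, x]) h t)%R).
move=> t t01.
have t2 : t < 2 by lra.
have t1 : -1 < t by lra.
have ih : (@lebesgue_measure R).-integrable `[(-1), 2] (EFin \o h).
  apply: continuous_compact_integrable; first exact: segment_compact.
  exact: continuous_subspaceT.
have [dF Ft] := continuous_FTC1_closed t2 ih t1 (ch t).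
move: dF Ft; set F := (F in derivable F) => dF; rewrite derive1E => <-.
exact: DeriveDef.
Qed.

Lemma mean_value01 (F : R -> R) h a b : 0 <= a -> a <= b -> b <= 1 ->
  (forall t, 0 <= t <= 1 -> is_derive t 1 F (h t)) ->
  exists2 c, a <= c <= b & F b - F a = h c * (b - a).
Proof.
move=> a0 ab b1 dF.
have [| |c] := @MVT_segment R F h a b ab; last by rewrite in_itv/=; exists c.
- by move=> x; rewrite in_itv/= => xab; apply: dF; lra.
- apply: derivable_within_continuous => x; rewrite in_itv/= => xab.
  by apply: (@ex_derive _ _ _ _ _ _ _ (dF x _)); lra.
Qed.

(* The sum over k of u k * 'C(n, k) * 'X^k * (1 - 'X)^(n - k), unfolded by
   Pascal's rule. *)
Fixpoint bernstein n (u : nat -> R) : {poly R} :=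
  if n is n'.+1 then
    (1 - 'X) * bernstein n' u + 'X * bernstein n' (fun k => u k.+1)
  else (u 0%N)%:P.

Lemma bernsteinS n u x : (bernstein n.+1 u).[x] =
  (1 - x) * (bernstein n u).[x] + x * (bernstein n (fun k => u k.+1)).[x].
Proof. by rewrite /= !hornerE. Qed.

Lemma bernstein_le n (u v : nat -> R) x : 0 <= x <= 1 ->
  (forall k, (k <= n)%N -> u k <= v k) ->
  (bernstein n u).[x] <= (bernstein n v).[x].
Proof.
move=> x01; elim: n u v => [|n IH] u v uv; first by rewrite !hornerE; exact: uv.
rewrite !bernsteinS lerD// ler_wpM2l//; try lra; apply: IH => k kn; apply: uv => //.
exact: leqW.
Qed.

Lemma bernstein_lin n (u v : nat -> R) (r s x : R) :
  (bernstein n (fun k => r * u k + s * v k)).[x] =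
  r * (bernstein n u).[x] + s * (bernstein n v).[x].
Proof.
elim: n u v => [|n IH] u v; first by rewrite !hornerE.
by rewrite !bernsteinS !IH; ring.
Qed.

Lemma bernstein_cst n (r x : R) : (bernstein n (fun=> r)).[x] = r.
Proof. by elim: n => [|n IH]; [rewrite /= hornerC|rewrite bernsteinS IH; ring]. Qed.

(** Squared bias plus variance of a binomial variable of parameters n and x. In the induction,
    shifting [k] by one amounts to shifting [r] by one. *)
Lemma bernstein_sqr n (r x : R) :
  (bernstein n (fun k => (k%:R - r) ^+ 2)).[x] =
  (n%:R * x - r) ^+ 2 + n%:R * x * (1 - x).
Proof.
elim: n r => [|n IH] r; first by rewrite /= hornerC; ring.
rewrite bernsteinS IH (_ : (fun k : nat => _) = (fun k => (k%:R - (r - 1)) ^+ 2)).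
  by rewrite IH -natr1; ring.
by apply/funext => k; rewrite -natr1; congr (_ ^+ 2); ring.
Qed.

Lemma weierstrass01 h (M e : R) : unif_cont_on 0 1 h ->
  (forall x, 0 <= x <= 1 -> `|h x| <= M) -> 0 < e ->
  exists p : {poly R}, forall x, 0 <= x <= 1 -> `|p.[x] - h x| <= e.
Proof.
move=> ch hM e0.
have e2 : 0 < e / 2 by lra.
have [d d0 hd] := ch _ e2.
have M0 : 0 <= M by apply: le_trans (hM 0 _) => //; lra.
(* Chosen so that 2M / (d^2 n) <= e / 2, which bounds the variance term because x (1 - x) <= 1. *)
pose n := (Num.bound (4 * M / (d ^+ 2 * e))).+1.
have n0 : 0 < n%:R :> R by rewrite ltr0n.
have nM : 2 * M / (d ^+ 2 * n%:R) <= e / 2.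
  have d20 : 0 < d ^+ 2 by rewrite exprn_gt0.
  rewrite ler_pdivrMr ?mulr_gt0//.
  have q0 : 0 <= 4 * M / (d ^+ 2 * e).
    by apply: divr_ge0; [rewrite mulr_ge0|rewrite mulr_ge0// ltW].
  have H : 4 * M / (d ^+ 2 * e) <= n%:R.
    by apply: ltW; apply: lt_le_trans (archi_boundP q0) _; rewrite ler_nat.
  rewrite ler_pdivrMr ?mulr_gt0// in H.
  by move: H; set N := n%:R; clearbody N; nra.
exists (bernstein n (fun k => h (k%:R / n%:R))) => x x01.
set C := 2 * M / (d ^+ 2 * n%:R ^+ 2).
have C0 : 0 <= C by rewrite divr_ge0 ?mulr_ge0 ?exprn_ge0//; lra.
(* Chebyshev's argument: nodes close to [x] are handled by uniform continuity, and at the others |k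
   - n x| >= n d, so the quadratic term is already at least 2M. *)
have key k : (k <= n)%N ->
    `|h (k%:R / n%:R) - h x| <= e / 2 + C * (k%:R - n%:R * x) ^+ 2.
  move=> kn; have kn01 : 0 <= (k%:R / n%:R : R) <= 1.
    by rewrite divr_ge0//= ler_pdivrMr// mul1r ler_nat.
  have [lt_d|ge_d] := ltP `|k%:R / n%:R - x| d.
    by apply: le_trans (hd _ _ kn01 x01 lt_d) _; rewrite lerDl mulr_ge0// sqr_ge0.
  apply: le_trans (ler_normB _ _) _.
  have : 2 * M <= C * (k%:R - n%:R * x) ^+ 2.
    rewrite (_ : k%:R - n%:R * x = (k%:R / n%:R - x) * n%:R); last first.
      by field; rewrite gt_eqF.
    rewrite (_ : C * _ = 2 * M * ((k%:R / n%:R - x) ^+ 2 / d ^+ 2)); last first.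
      by rewrite /C; field; rewrite !gt_eqF.
    rewrite ler_peMr ?mulr_ge0// ler_pdivlMr ?exprn_gt0// mul1r.
    by rewrite -(real_normK (num_real (_ - x))) lerXn2r// ?nnegrE// ltW.
  have := hM _ kn01; have := hM _ x01; lra.
have var : (bernstein n (fun k => e / 2 * 1 + C * (k%:R - n%:R * x) ^+ 2)).[x] <= e.
  rewrite (bernstein_lin n (fun=> 1) (fun k => (k%:R - n%:R * x) ^+ 2)).
  rewrite bernstein_cst bernstein_sqr subrr expr0n/= add0r mulr1.
  have -> : C * (n%:R * x * (1 - x)) = 2 * M / (d ^+ 2 * n%:R) * (x * (1 - x)).
    by rewrite /C; field; rewrite !gt_eqF.
  have : 0 <= 2 * M / (d ^+ 2 * n%:R) by rewrite divr_ge0 ?mulr_ge0 ?exprn_ge0//; lra.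
  set q := 2 * M / _ in nM *; nra.
(* The error is itself a Bernstein value, with coefficients h(k/n) - h(x); monotonicity in the
   coefficients then bounds it from both sides. *)
have E : (bernstein n (fun k => 1 * h (k%:R / n%:R) + (- h x) * 1)).[x] =
   (bernstein n (fun k => h (k%:R / n%:R))).[x] - h x.
  by rewrite (bernstein_lin n _ (fun=> 1)) bernstein_cst mul1r mulr1.
rewrite ler_norml -E; apply/andP; split; last first.
  apply: le_trans var; apply: bernstein_le => // k /key; rewrite ler_norml; lra.
rewrite lerNl; apply: le_trans var.
rewrite -[leLHS]mulN1r -[leLHS]addr0 -[X in _ + X](mul0r (bernstein n (fun=> 1)).[x]).
rewrite -bernstein_lin; apply: bernstein_le => // k /key; rewrite ler_norml; lra.
Qed.

Lemma weierstrass h a b (M e : R) : a < b -> unif_cont_on a b h ->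
  (forall x, a <= x <= b -> `|h x| <= M) -> 0 < e ->
  exists p : {poly R}, forall x, a <= x <= b -> `|p.[x] - h x| <= e.
Proof.
move=> ab ch hM e0.
have ba : 0 < b - a by lra.
have aff x : 0 <= x <= 1 -> a <= a + (b - a) * x <= b by nra.
have [||p hp] := @weierstrass01 (fun x => h (a + (b - a) * x)) M e _ _ e0.
- move=> r r0; have [d d0 hd] := ch r r0.
  exists (d / (b - a)) => [|x y x01 y01]; first by rewrite divr_gt0.
  rewrite ltr_pdivlMr// => xy; apply: hd; rewrite ?aff//.
  rewrite (_ : _ - _ = (x - y) * (b - a)); last by ring.
  by rewrite normrM (gtr0_norm ba).
- by move=> x x01; apply: hM; exact: aff.
- exists (p \Po ((b - a)^-1 *: ('X - a%:P))) => x xab.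
  rewrite horner_comp !hornerE.
  have := hp ((b - a)^-1 * (x - a)).
  rewrite mulrA divff ?gt_eqF// mul1r addrCA subrr addr0; apply.
  by rewrite mulrC divr_ge0/= ?ler_pdivrMr//; lra.
Qed.

(** Bundles the conditions that [is_op_integral] puts on [s] and [xi], for the interval [0, 1]. *)
Definition tagged_partition d (s : seq R) (xi : nat -> R) : Prop :=
  itv_partition 0 1 s /\
  forall i, (i < size s)%N ->
    nth 1 (0 :: s) i <= xi i <= nth 1 (0 :: s) i.+1 /\
    nth 1 (0 :: s) i.+1 - nth 1 (0 :: s) i < d.

Lemma tagged_partition_itv d s xi i : tagged_partition d s xi ->
  (i < size s)%N -> 0 <= xi i <= 1.
Proof.
move=> [ps hs] ilt; have [/andP[h1 h2] _] := hs i ilt.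
rewrite (le_trans _ h1)/= ?(le_trans h2)//.
  exact: itv_partition_nth_le.
by apply: itv_partition_nth_ge => //; exact: ltnW.
Qed.

(** With [F] the identity, the weights of a Riemann sum add up to 1; with an antiderivative, the
    integral is split along the cells. *)
Lemma sum_tagged_partition d s xi (F : R -> R) : tagged_partition d s xi ->
  \sum_(i < size s) (F (nth 1 (0 :: s) i.+1) - F (nth 1 (0 :: s) i)) = F 1 - F 0.
Proof.
move=> [ps _].
rewrite -(big_mkord xpredT (fun i => F (nth 1 (0 :: s) i.+1) - F (nth 1 (0 :: s) i))).
rewrite (telescope_sumr (fun i => F (nth 1 (0 :: s) i)))//.
by rewrite (itv_partition_nth_size _ ps).
Qed.

(** On each cell the increment of [F] is the length times [h c] for some c of the cell. The tag is
    at distance less than [d] from c, and the lengths add up to 1. *)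
Lemma riemann_sum_mean_value (F : R -> R) h d e s xi :
  (forall t, 0 <= t <= 1 -> is_derive t 1 F (h t)) ->
  (forall x y, 0 <= x <= 1 -> 0 <= y <= 1 -> `|x - y| < d -> `|h x - h y| <= e) ->
  tagged_partition d s xi ->
  `|\sum_(i < size s) (nth 1 (0 :: s) i.+1 - nth 1 (0 :: s) i) * h (xi i)
    - (F 1 - F 0)| <= e.
Proof.
move=> dF hd ps; rewrite -(sum_tagged_partition F ps) -sumrB.
apply: le_trans (ler_norm_sum _ _ _) _.
have -> : e = \sum_(i < size s) (nth 1 (0 :: s) i.+1 - nth 1 (0 :: s) i) * e.
  by rewrite -mulr_suml (sum_tagged_partition id ps) subr0 mul1r.
apply: ler_sum => -[i ilt] _ /=.
have [/andP[h1 h2] h3] := ps.2 i ilt.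
have g0 : 0 <= nth 1 (0 :: s) i by apply: itv_partition_nth_ge ps.1; exact: ltnW.
have g1 : nth 1 (0 :: s) i.+1 <= 1 by exact: itv_partition_nth_le ps.1.
rewrite -[_ (0 :: s) i.+1]/(nth 1 (0 :: s) i.+1) in h2 h3 g1 *.
have [c /andP[c1 c2] ->] := mean_value01 g0 (le_trans h1 h2) g1 dF.
set u := nth _ _ i in h1 h3 g0 c1 *; set v := nth _ _ _ in h2 h3 g1 c2 *.
have -> : (v - u) * h (xi i) - h c * (v - u) = (v - u) * (h (xi i) - h c) by ring.
rewrite normrM ger0_norm; last by lra.
apply: ler_wpM2l; first by lra.
apply: hd; try lra.
by rewrite ltr_norml; apply/andP; split; lra.
Qed.

Lemma segment_combination_itv n m x t :
  0 <= n <= m -> 0 <= x <= m -> 0 <= t <= 1 -> 0 <= (1 - t) * x + t * n <= m.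
Proof. by move=> ? ? ?; apply/andP; split; nra. Qed.

End RealAnalysis.

Section SegmentMean.
Context {R : realType}.
Variables (f : R -> R) (n m : R).
Hypothesis cf : {within `[0, +oo[, continuous f}.
Hypothesis nm : 0 <= n <= m.

Let f0 (x : R) := f (Num.max 0 x).

Lemma unif_cont_on_nneg c : unif_cont_on 0 c f.
Proof.
move=> e e0.
have [d d0 hd] := continuous_unif_cont_on 0 c (continuous_comp_max0 cf) e0.
exists d => // x y x0 y0 xy; have := hd x y x0 y0 xy.
by rewrite !max_r//; [case/andP: y0|case/andP: x0].
Qed.

(* g x is the mean of f over the segment from x to n. *)
Lemma segment_mean : exists g : R -> R,
  [/\ unif_cont_on 0 m g,
      forall x, 0 <= x <= m ->
        exists2 t, 0 <= t <= 1 & g x = f ((1 - t) * x + t * n) &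
      forall e, 0 < e -> exists2 d, 0 < d &
        forall s xi x, tagged_partition d s xi -> 0 <= x <= m ->
        `|\sum_(i < size s) (nth 1 (0 :: s) i.+1 - nth 1 (0 :: s) i)
            * f ((1 - xi i) * x + xi i * n) - g x| <= e].
Proof.
have cf0 : continuous f0 by exact: continuous_comp_max0.
pose k (x t : R) := f0 ((1 - t) * x + t * n).
have ck x : continuous (k x).
  have cl : continuous (fun t : R => (1 - t) * x + t * n).
    move=> t; apply: cvgD; apply: cvgM; try exact: cvg_cst; last exact: cvg_id.
    by apply: cvgB; [exact: cvg_cst|exact: cvg_id].
  by move=> t; exact: (continuous_comp (cl t) (cf0 _)).
have kE (x t : R) : 0 <= x <= m -> 0 <= t <= 1 -> k x t = f ((1 - t) * x + t * n).
  move=> xm t01; rewrite /k /f0 max_r//.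
  by case/andP: (segment_combination_itv nm xm t01).
have [F dF] := choice (fun x => antiderivative (ck x)).
have O1 : (0 : R) <= 1 by [].
exists (fun x => F x 1 - F x 0); split.
- move=> e e0; have [d d0 hd] := unif_cont_on_nneg m e0.
  exists d => // x y xm ym xy.
  (* The mean value theorem is applied to the difference, so that a single point c serves both [x]
     and [y]. *)
  have dFF (t : R) : 0 <= t <= 1 -> is_derive t 1 (F x - F y) (k x t - k y t).
    by move=> t01; apply: is_deriveB; exact: dF.
  have [c c01] := mean_value01 (lexx 0) O1 (lexx 1) dFF.
  rewrite subr0 mulr1 /= !fctE => Ec.
  rewrite (_ : _ - _ = k x c - k y c); last by rewrite -Ec; ring.
  rewrite !kE//; apply: hd; try exact: segment_combination_itv.
  rewrite (_ : _ - _ = (1 - c) * (x - y)); last by ring.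
  rewrite normrM (le_lt_trans _ xy)// ler_piMl// ger0_norm; lra.
- move=> x xm; have [c c01] := mean_value01 (lexx 0) O1 (lexx 1) (dF x).
  by rewrite subr0 mulr1 => ->; exists c; rewrite ?kE.
- move=> e e0; have [d d0 hd] := unif_cont_on_nneg m e0.
  have m0 : 0 <= m by case/andP: nm; exact: le_trans.
  (* Moving t to u displaces the point of the segment by |t - u| |n - x| <= |t - u| m, whatever [x];
     the denominator m + 1 covers m = 0. Uniformity in [x] is what later gives convergence in
     operator norm. *)
  exists (d / (m + 1)); first by rewrite divr_gt0//; lra.
  move=> s xi x ps xm.
  rewrite (eq_bigr (fun i : 'I_(size s) =>
      (nth 1 (0 :: s) i.+1 - nth 1 (0 :: s) i) * k x (xi i))); last first.
    by move=> i _; rewrite kE//; exact: (tagged_partition_itv ps).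
  apply: (riemann_sum_mean_value (dF x) _ ps) => t u t01 u01.
  rewrite ltr_pdivlMr => [tu|]; last by lra.
  rewrite !kE//; apply: hd; try exact: segment_combination_itv.
  rewrite (_ : _ - _ = (t - u) * (n - x)); last by ring.
  rewrite normrM (le_lt_trans _ tu)// ler_wpM2l// ler_norml.
  by case/andP: nm => ? ?; apply/andP; split; lra.
Qed.

End SegmentMean.

(** * The real Hilbert space structure *)

(** Evaluate at the minimiser -b / a. If a = 0 and b is nonzero, the affine function takes the value
    -1 at the point chosen below. *)
Lemma discriminant_le (R : realFieldType) (a b c : R) : 0 <= a ->
  (forall t, 0 <= a * t ^+ 2 + 2 * b * t + c) -> b ^+ 2 <= a * c.
Proof.
rewrite le_eqVlt => /predU1P[<- | a0] H.
  rewrite mul0r; have [->|b0] := eqVneq b 0; first by rewrite expr0n.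
  have := H (- (c + 1) / (2 * b)).
  rewrite (_ : _ + _ = -1); first by lra.
  by field.
have := H (- b / a).
rewrite (_ : _ + _ = (a * c - b ^+ 2) / a); last by field; rewrite gt_eqF.
by rewrite pmulr_lge0 ?invr_gt0// subr_ge0.
Qed.

Lemma eps_eq0 (R : realFieldType) (a C : R) :
  0 <= a -> (forall e, 0 < e -> a <= e * C) -> a = 0.
Proof.
move=> a0 aC; apply/eqP; rewrite eq_le a0 andbT.
have [C0|C0] := leP C 0.
  by have := aC 1 ltr01; rewrite mul1r => /le_trans; apply.
rewrite leNgt; apply/negP => a_gt0.
have := aC (a / (2 * C)); rewrite divr_gt0 ?mulr_gt0// => /(_ isT).
rewrite (_ : a / (2 * C) * C = a / 2); first by move=> ?; lra.
by field; rewrite gt_eqF.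
Qed.

Lemma archi_inv_le (R : realType) (C e : R) : 0 <= C -> 0 < e ->
  exists N, forall k, (N <= k)%N -> C / k.+1%:R <= e.
Proof.
move=> C0 e0; exists (Num.bound (C / e)) => k Nk.
rewrite ler_pdivrMr ?ltr0n// mulrC -ler_pdivrMr//.
apply: ltW; apply: lt_le_trans (archi_boundP _) _; first by rewrite divr_ge0// ltW.
by rewrite ler_nat ltnW.
Qed.

Section RealHilbert.
Context {R : realType} {H : hilbertType R}.
Implicit Types (x y z : H) (r s M : R) (T S : H -> H).

(** Real parts make the space a real Hilbert space with the same norm, so that estimates take place
    in the ordered field [R]. *)
Definition rnorm x : R := complex.Re `|x|.
Definition rinner x y : R := complex.Re (inner x y).

Lemma rnormE x : `|x| = (rnorm x)%:C.
Proof. by rewrite /rnorm RRe_real// ger0_real. Qed.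

Lemma rnorm_ge0 x : 0 <= rnorm x.
Proof. by rewrite -ler0c -rnormE. Qed.
Hint Resolve rnorm_ge0 : core.

Lemma rnorm0 : rnorm 0 = 0.
Proof. by apply: complexI; rewrite -rnormE normr0. Qed.

Lemma rnorm_eq0 x : rnorm x = 0 -> x = 0.
Proof. by move=> x0; apply/normr0_eq0; rewrite rnormE x0. Qed.

Lemma rnorm_gt0 x : x != 0 -> 0 < rnorm x.
Proof.
by move=> x0; rewrite lt_neqAle rnorm_ge0 andbT eq_sym; apply: contra_neq x0 => /rnorm_eq0.
Qed.

Lemma rnormD x y : rnorm (x + y) <= rnorm x + rnorm y.
Proof. by have := ler_normD x y; rewrite !rnormE -rmorphD lecR. Qed.

Lemma rnormN x : rnorm (- x) = rnorm x.
Proof. by rewrite /rnorm normrN. Qed.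

Lemma rnormB x y : rnorm (x - y) <= rnorm x + rnorm y.
Proof. by rewrite -(rnormN y) rnormD. Qed.

Lemma rdistC x y : rnorm (x - y) = rnorm (y - x).
Proof. by rewrite -rnormN opprB. Qed.

Lemma rnorm_sum n (F : 'I_n -> H) : rnorm (\sum_i F i) <= \sum_i rnorm (F i).
Proof.
elim/big_ind2 : _ => [|a b c d h1 h2|//]; first by rewrite rnorm0.
by apply: le_trans (rnormD _ _) _; exact: lerD.
Qed.

Lemma rnormZ (c : R[i]) x : rnorm (c *: x) = complex.Re `|c| * rnorm x.
Proof.
have cE : `|c| = (complex.Re `|c|)%:C by rewrite RRe_real// ger0_real.
by have := normrZ c x; rewrite !rnormE cE -rmorphM => /complexI.
Qed.

Lemma Re_norm_ge0 (c : R[i]) : 0 <= complex.Re `|c|.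
Proof. by rewrite -ler0c RRe_real. Qed.

Lemma Re_norm_real r : complex.Re `|r%:C : R[i]| = `|r|.
Proof. by rewrite normc_def/= expr0n addr0 sqrtr_sqr. Qed.

Lemma rnormZr r x : rnorm (r%:C *: x) = `|r| * rnorm x.
Proof. by rewrite rnormZ Re_norm_real. Qed.

Lemma innerDl x y z : inner (x + y) z = inner x z + inner y z.
Proof. by rewrite -[x]scale1r inner_linearl mul1r scale1r. Qed.

Lemma inner0l z : inner 0 z = 0.
Proof. by apply: (addrI (inner 0 z)); rewrite -innerDl !addr0. Qed.

Lemma innerZl c x z : inner (c *: x) z = c * inner x z.
Proof. by rewrite -[c *: x]addr0 inner_linearl inner0l addr0. Qed.

Lemma rinnerC x y : rinner x y = rinner y x.
Proof. by rewrite /rinner inner_conj; case: (inner y x). Qed.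

Lemma rinnerDl x y z : rinner (x + y) z = rinner x z + rinner y z.
Proof. by rewrite /rinner innerDl raddfD. Qed.

Lemma rinnerZl r x z : rinner (r%:C *: x) z = r * rinner x z.
Proof. by rewrite /rinner innerZl; case: (inner x z) => a b /=; rewrite mul0r subr0. Qed.

Lemma rinnerDr x y z : rinner z (x + y) = rinner z x + rinner z y.
Proof. by rewrite ![rinner z _]rinnerC rinnerDl. Qed.

Lemma rinnerZr r x z : rinner z (r%:C *: x) = r * rinner z x.
Proof. by rewrite ![rinner z _]rinnerC rinnerZl. Qed.

Lemma rinnerNl x z : rinner (- x) z = - rinner x z.
Proof.
by have := rinnerZl (-1) x z; rewrite mulN1r => <-; rewrite rmorphN1 scaleN1r.
Qed.

Lemma rinnerNr x z : rinner z (- x) = - rinner z x.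
Proof. by rewrite ![rinner z _]rinnerC rinnerNl. Qed.

Lemma rinnerBl x y z : rinner (x - y) z = rinner x z - rinner y z.
Proof. by rewrite rinnerDl rinnerNl. Qed.

Lemma rinnerBr x y z : rinner z (x - y) = rinner z x - rinner z y.
Proof. by rewrite rinnerDr rinnerNr. Qed.

Lemma rinnerxx x : rinner x x = rnorm x ^+ 2.
Proof. by rewrite /rinner inner_norm rnormE -rmorphXn. Qed.

(** The way back: an identity between real inner products that holds for all vectors lifts to the
    complex ones. *)
Lemma inner_rinner x y : inner x y = rinner x y +i* - rinner ('i%C *: x) y.
Proof.
rewrite /rinner innerZl; case: (inner x y) => a b /=.
by rewrite mul0r mul1r sub0r opprK.
Qed.

Lemma cauchy_schwarz x y : `|rinner x y| <= rnorm x * rnorm y.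
Proof.
rewrite -(@ler_pXn2r _ 2)// ?nnegrE ?mulr_ge0// exprMn real_normK ?num_real//.
rewrite mulrC; apply: discriminant_le; first by rewrite exprn_ge0.
move=> t; have := sqr_ge0 (rnorm (x + t%:C *: y)); congr (0 <= _).
rewrite -rinnerxx !(rinnerDl, rinnerDr, rinnerZl, rinnerZr) (rinnerC y x) !rinnerxx.
by ring.
Qed.

Lemma rinner_le x y : rinner x y <= rnorm x * rnorm y.
Proof. exact: le_trans (ler_norm _) (cauchy_schwarz x y). Qed.

Lemma rinner_eq x y : (forall z, rinner x z = rinner y z) -> x = y.
Proof.
move=> xy; apply/eqP; rewrite -subr_eq0; apply/eqP/rnorm_eq0/eqP.
by rewrite -sqrf_eq0 -rinnerxx rinnerBl xy subrr.
Qed.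

Lemma rnorm_eps_eq0 x C : (forall e, 0 < e -> rnorm x <= e * C) -> x = 0.
Proof. by move=> xC; apply/rnorm_eq0/(eps_eq0 (rnorm_ge0 x) xC). Qed.

Lemma cauchy_sequence_converges (u : nat -> H) :
  (forall e, 0 < e -> exists N, forall i j, (N <= i)%N -> (N <= j)%N ->
     rnorm (u i - u j) <= e) ->
  exists l, forall e, 0 < e -> exists N, forall i, (N <= i)%N -> rnorm (u i - l) <= e.
Proof.
move=> cu.
have : cvgn u.
  apply/cauchy_cvgP/cauchy_ballP => e.
  rewrite ltcE /= => /andP[/eqP eI e0].
  have eE : e = (complex.Re e)%:C by case: e eI {e0} => a b /= ->.
  have e2 : 0 < complex.Re e / 2 by lra.
  have [N hN] := cu _ e2.
  pose V := [set x | exists2 i, (N <= i)%N & x = u i].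
  exists (V, V) => /=; first by split; exists N => // i Ni; exists i.
  move=> [_ _] /= [[i Ni ->] [j Nj ->]]; rewrite -ball_normE /= eE rnormE ltcR.
  by apply: le_lt_trans (hN i j Ni Nj) _; lra.
move=> /cvg_ex[l ul]; exists l => e e0.
have e0C : 0 < e%:C :> R[i] by rewrite ltcR.
have /cvgrPdist_le/(_ _ e0C)[N _ hN] := ul.
exists N => i Ni; have := hN i Ni; rewrite rnormE lecR rdistC; exact.
Qed.

End RealHilbert.
#[global] Hint Extern 0 (is_true (0 <= rnorm _)) => exact: rnorm_ge0 : core.

(** * Bounded symmetric operators *)

Section SymmetricOperators.
Context {R : realType} {H : hilbertType R}.
Implicit Types (x y z : H) (r s c e M : R) (T S : H -> H).

Lemma linearopD T x y : linear T -> T (x + y) = T x + T y.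
Proof. by move=> lT; rewrite -[x]scale1r lT !scale1r. Qed.

Lemma linearop0 T : linear T -> T 0 = 0.
Proof. by move=> lT; apply: (addrI (T 0)); rewrite -linearopD// !addr0. Qed.

Lemma linearopZ T (c : R[i]) x : linear T -> T (c *: x) = c *: T x.
Proof. by move=> lT; rewrite -[c *: x]addr0 lT linearop0// addr0. Qed.

Lemma linearopN T x : linear T -> T (- x) = - T x.
Proof. by move=> lT; rewrite -scaleN1r linearopZ// scaleN1r. Qed.

Lemma linearopB T x y : linear T -> T (x - y) = T x - T y.
Proof. by move=> lT; rewrite linearopD// linearopN. Qed.

Lemma bounded_operatorP T : bounded_operator T <->
  linear T /\ exists2 M, 0 <= M & forall x, rnorm (T x) <= M * rnorm x.
Proof.
split=> -[lT [M]].
- move=> hM; split=> //; exists `|M| => // x.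
  apply: (@le_trans _ _ (M * rnorm x)); last by rewrite ler_wpM2r// ler_norm.
  by have := hM x; rewrite !rnormE -rmorphM lecR.
- by move=> M0 hM; split => //; exists M => x; rewrite !rnormE -rmorphM lecR.
Qed.

Lemma bounded_operator_id : bounded_operator (idfun : H -> H).
Proof. by apply/bounded_operatorP; split => //; exists 1 => // x; rewrite mul1r. Qed.

Lemma bounded_operatorD T S :
  bounded_operator T -> bounded_operator S -> bounded_operator (T + S).
Proof.
move=> /bounded_operatorP[lT [M M0 hM]] /bounded_operatorP[lS [N N0 hN]].
apply/bounded_operatorP; split.
  by move=> a x y; rewrite !fctE lT lS scalerDr addrACA.
exists (M + N) => [|x]; first exact: addr_ge0.
by rewrite mulrDl (le_trans (rnormD _ _))// lerD.
Qed.

Lemma bounded_operatorZ (a : R[i]) T :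
  bounded_operator T -> bounded_operator (a *: T).
Proof.
move=> /bounded_operatorP[lT [M M0 hM]]; apply/bounded_operatorP; split.
  by move=> b x y; rewrite !fctE lT scalerDr !scalerA mulrC.
exists (complex.Re `|a| * M) => [|x].
  by rewrite mulr_ge0// Re_norm_ge0.
rewrite -mulrA rnormZ ler_wpM2l ?Re_norm_ge0 ?hM//.
Qed.

Lemma bounded_operatorB T S :
  bounded_operator T -> bounded_operator S -> bounded_operator (T - S).
Proof.
move=> bT bS; rewrite -[- S]scaleN1r; apply: bounded_operatorD => //.
exact: bounded_operatorZ.
Qed.

Lemma bounded_operator_comp T S :
  bounded_operator T -> bounded_operator S -> bounded_operator (T \o S).
Proof.
move=> /bounded_operatorP[lT [M M0 hM]] /bounded_operatorP[lS [N N0 hN]].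
apply/bounded_operatorP; split; first by move=> a x y; rewrite /= lS lT.
exists (M * N) => [|x]; first exact: mulr_ge0.
by rewrite /= (le_trans (hM _))// -mulrA ler_wpM2l.
Qed.

Lemma bounded_operator_sum n (F : 'I_n -> H -> H) :
  (forall i, bounded_operator (F i)) -> bounded_operator (\sum_i F i).
Proof.
move=> bF; elim/big_ind : _ => // [|T S]; last exact: bounded_operatorD.
rewrite -(scale0r (idfun : H -> H)); apply: bounded_operatorZ.
exact: bounded_operator_id.
Qed.

Lemma opnorm_has_sup T : bounded_operator T ->
  has_sup [set complex.Re `|T x| | x in [set x : H | `|x| <= 1]].
Proof.
move=> /bounded_operatorP[lT [M M0 hM]]; split.
  by exists (complex.Re `|T 0|); exists 0 => //=; rewrite normr0.
exists M => _ [x /= x1 <-]; apply: le_trans (hM x) _.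
by rewrite ler_piMr// -lecR -rnormE.
Qed.

Lemma opnorm_ge0 T : bounded_operator T -> 0 <= opnorm T.
Proof.
move=> bT; apply: (@le_trans _ _ (complex.Re `|T 0|)); first exact: rnorm_ge0.
apply: ub_le_sup; first by case: (opnorm_has_sup bT).
by exists 0 => //=; rewrite normr0.
Qed.

Lemma rnorm_le_opnorm T x : bounded_operator T -> rnorm (T x) <= opnorm T * rnorm x.
Proof.
move=> bT; have lT := bT.1.
have [->|x0] := eqVneq x 0; first by rewrite linearop0// rnorm0 mulr0.
have n0 := rnorm_gt0 x0.
rewrite -ler_pdivrMr//.
have -> : rnorm (T x) / rnorm x = rnorm (T ((rnorm x)^-1%:C *: x)).
  by rewrite linearopZ// rnormZr ger0_norm ?invr_ge0// mulrC.
apply: ub_le_sup; first by case: (opnorm_has_sup bT).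
exists ((rnorm x)^-1%:C *: x) => //=.
rewrite rnormE rnormZr ger0_norm ?invr_ge0// mulVf ?gt_eqF//.
Qed.

Lemma opnorm_le T M : 0 <= M -> (forall x, rnorm (T x) <= M * rnorm x) ->
  opnorm T <= M.
Proof.
move=> M0 hM; apply: sup_le_ub.
  by exists (complex.Re `|T 0|); exists 0 => //=; rewrite normr0.
move=> _ [x /= x1 <-]; apply: le_trans (hM x) _.
by rewrite ler_piMr// -lecR -rnormE.
Qed.

(* Symmetric Lax-Milgram: minimise [q x - 2 phi x], where q is the quadratic
   form of T. The case T = id is the Riesz representation theorem. *)
Lemma coercive_representation T c M K (phi : H -> R) :
  linear T -> (forall x y, rinner (T x) y = rinner x (T y)) ->
  (forall x, rnorm (T x) <= M * rnorm x) ->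
  0 < c -> (forall x, c * rnorm x ^+ 2 <= rinner (T x) x) ->
  (forall x y, phi (x + y) = phi x + phi y) ->
  (forall r x, phi (r%:C *: x) = r * phi x) ->
  (forall x, `|phi x| <= K * rnorm x) ->
  exists x0, forall h, rinner (T x0) h = phi h.
Proof.
move=> lT sT hM c0 hc phiD phiZ hK.
pose q x := rinner (T x) x; pose J x := q x - 2 * phi x.
(* Completing the square in c |x|^2 - 2 K |x|. *)
have J_ge x : - (K ^+ 2 / c) <= J x.
  have := hc x; have := hK x; rewrite ler_norml => /andP[_ h1] h2.
  have : 0 <= (c * rnorm x - K) ^+ 2 / c by rewrite divr_ge0 ?sqr_ge0// ltW.
  rewrite (_ : (c * rnorm x - K) ^+ 2 / c =
    c * rnorm x ^+ 2 - 2 * (K * rnorm x) + K ^+ 2 / c); last first.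
    by field; rewrite gt_eqF.
  rewrite /J /q; lra.
have JD x y t : J (x + t%:C *: y) =
    J x + 2 * t * (rinner (T x) y - phi y) + t ^+ 2 * q y.
  rewrite /J /q phiD phiZ linearopD// linearopZ//.
  rewrite !(rinnerDl, rinnerDr, rinnerZl, rinnerZr) [rinner (T y) x]rinnerC -sT.
  by ring.
have hinf : has_inf (range J).
  split; first by exists (J 0); exists 0.
  by exists (- (K ^+ 2 / c)) => _ [x _ <-].
set I := inf (range J).
have J_I x : I <= J x by apply: ge_inf; [exact: hinf.2|exists x].
have ex k : exists x, J x <= I + k.+1%:R^-1.
  have k0 : (0 : R) < k.+1%:R^-1 by rewrite invr_gt0 ltr0n.
  by have [_ [x _ <-] hx] := inf_adherent k0 hinf; exists x; exact: ltW.
have [u hu] := choice ex.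
(* Parallelogram identity at the midpoint: since J is at least its infimum there, two
   near-minimisers are close, and the sequence [u] is Cauchy. *)
have qB x y : q (y - x) = 2 * (J x + J y - 2 * J (x + (2^-1)%:C *: (y - x))).
  have := JD x (y - x) 1; rewrite scale1r [x + _]addrC subrK => ->.
  by rewrite JD; field.
have [l hl] : exists l, forall e, 0 < e ->
    exists N, forall i, (N <= i)%N -> rnorm (u i - l) <= e.
  apply: cauchy_sequence_converges => e e0.
  have [N hN] := @archi_inv_le R 4 (c * e ^+ 2) (ler0n _ 4) (mulr_gt0 c0 (exprn_gt0 2 e0)).
  exists N => i j Ni Nj.
  rewrite -(@ler_pXn2r _ 2)// ?nnegrE ?(ltW e0)// -(ler_pM2l c0).
  apply: le_trans (hc _) _; rewrite -/(q _) qB.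
  have invN k : (N <= k)%N -> k.+1%:R^-1 <= N.+1%:R^-1 :> R.
    by move=> Nk; rewrite lef_pV2 ?posrE ?ltr0n// ler_nat.
  have := J_I (u j + (2^-1)%:C *: (u i - u j)).
  have := hN N (leqnn N); have := hu i; have := hu j.
  have := invN _ Ni; have := invN _ Nj.
  move: (N.+1%:R^-1) (i.+1%:R^-1) (j.+1%:R^-1) (J _) (J _) (J _) (c * e ^+ 2) => *; lra.
exists l => h; apply/eqP; rewrite -subr_eq0 -normr_eq0; apply/eqP.
have q0 : 0 <= q h by apply: le_trans (hc h); rewrite mulr_ge0 ?exprn_ge0// ltW.
apply: (@eps_eq0 _ _ (1 + `|M| * rnorm h)) => // e e0.
have [N1 h1] := archi_inv_le q0 (exprn_gt0 2 e0); have [N2 h2] := hl e e0.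
pose k := maxn N1 N2.
have hk1 := h1 k (leq_maxl _ _); have hk2 := h2 k (leq_maxr _ _).
(* Approximate Euler-Lagrange equation: J (u k + t h) >= I for all real t is a nonnegative quadratic
   in t with constant term at most 1 / (k + 1). *)
have b2 : (rinner (T (u k)) h - phi h) ^+ 2 <= q h * k.+1%:R^-1.
  apply: discriminant_le => // t; have := JD (u k) h t.
  have := J_I (u k + t%:C *: h); have := hu k.
  move: (J _) (J _) (k.+1%:R^-1) (q h) (_ - phi h) => J1 J2 v w b i1 i2 i3.
  by rewrite i3 in i2; lra.
have {}b2 : `|rinner (T (u k)) h - phi h| <= e.
  rewrite -(@ler_pXn2r _ 2)// ?nnegrE ?(ltW e0)// real_normK ?num_real//.
  exact: le_trans hk1.
rewrite (_ : rinner (T l) h - phi h =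
  (rinner (T (u k)) h - phi h) - rinner (T (u k - l)) h); last first.
  by rewrite linearopB// rinnerBl; ring.
apply: le_trans (ler_normB _ _) _; rewrite mulrDr mulr1 lerD//.
apply: le_trans (cauchy_schwarz _ _) _; rewrite mulrA ler_wpM2r//.
apply: le_trans (hM _) _; apply: (@le_trans _ _ (`|M| * rnorm (u k - l))).
  by rewrite ler_wpM2r// ler_norm.
by rewrite mulrC ler_wpM2r.
Qed.

(** Riesz representation of x |-> [rinner (T x) y] gives the value at [y]. The identity then lifts
    to [inner], whose conjugate linearity in the second argument yields linearity over [R[i]]. *)
Lemma adjointP T : bounded_operator T -> is_adjoint T (adjoint T).
Proof.
move=> bT; have /bounded_operatorP[lT [M M0 hM]] := bT.
suff ex : [set B | is_adjoint T B] !=set0 by exact: (xgetPex 0 ex).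
have rep y : exists b, forall h, rinner b h = rinner (T h) y.
  apply: (@coercive_representation idfun 1 1 (M * rnorm y)) => //.
  - by move=> x; rewrite mul1r.
  - by move=> x; rewrite mul1r rinnerxx.
  - by move=> x z; rewrite linearopD// rinnerDl.
  - by move=> r x; rewrite linearopZ// rinnerZl.
  - by move=> x; rewrite mulrAC (le_trans (cauchy_schwarz _ _))// ler_wpM2r.
have [B hB] := choice rep.
have hBr x y : rinner (T x) y = rinner x (B y) by rewrite -hB rinnerC.
have adj x y : inner (T x) y = inner x (B y).
  by rewrite !inner_rinner -linearopZ// !hBr.
have innerDr x y z : inner z (x + y) = inner z x + inner z y.
  by rewrite inner_conj innerDl rmorphD /= -!inner_conj.
have innerZr a x z : inner z (a *: x) = a^* * inner z x.
  by rewrite inner_conj innerZl rmorphM /= -inner_conj.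
exists B; split=> //; apply/bounded_operatorP; split.
  move=> a x y; apply: rinner_eq => z; rewrite ![rinner _ z]rinnerC.
  congr (complex.Re _); rewrite -adj innerDr innerZr innerDr innerZr.
  by rewrite -!adj.
exists M => // x.
(* |B x|^2 = <T (B x), x> <= M |B x| |x|, and one factor |B x| cancels. *)
have := rinner_le (T (B x)) x; rewrite hBr rinnerxx => h.
have [->|n0] := eqVneq (rnorm (B x)) 0; first by rewrite mulr_ge0.
have {}n0 : 0 < rnorm (B x) by rewrite lt_neqAle eq_sym n0 rnorm_ge0.
rewrite -(ler_pM2l n0); apply: le_trans h _.
by rewrite mulrCA mulrA ler_wpM2r.
Qed.

(** Lax-Milgram gives surjectivity; Cauchy-Schwarz turns coercivity into c |x| <= |T x|, hence
    injectivity and the bound 1 / c for the inverse. *)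
Lemma coercive_invertible T c :
  bounded_operator T -> (forall x y, rinner (T x) y = rinner x (T y)) ->
  0 < c -> (forall x, c * rnorm x ^+ 2 <= rinner (T x) x) ->
  exists B, [/\ bounded_operator B, B \o T = idfun & T \o B = idfun].
Proof.
move=> /bounded_operatorP[lT [M M0 hM]] sT c0 hc.
have surj y : exists x, T x = y.
  have [x hx] : exists x, forall h, rinner (T x) h = rinner y h.
    apply: (@coercive_representation T c M (rnorm y)) => // *;
      by rewrite ?rinnerDr ?rinnerZr ?cauchy_schwarz.
  by exists x; apply: rinner_eq => z; exact: hx.
have below x : c * rnorm x <= rnorm (T x).
  have [->|n0] := eqVneq (rnorm x) 0; first by rewrite mulr0.
  have {}n0 : 0 < rnorm x by rewrite lt_neqAle eq_sym n0 rnorm_ge0.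
  rewrite -(ler_pM2r n0) -mulrA -expr2; exact: le_trans (hc x) (rinner_le _ _).
have inj x y : T x = T y -> x = y.
  move=> xy; apply/eqP; rewrite -subr_eq0; apply/eqP/rnorm_eq0/eqP.
  rewrite eq_le rnorm_ge0 andbT -(ler_pM2l c0) mulr0.
  by apply: le_trans (below _) _; rewrite linearopB// xy subrr rnorm0.
have [B hB] := choice surj.
exists B; split; [|by apply/funext => x; apply: inj; rewrite /= hB|by apply/funext].
apply/bounded_operatorP; split.
  by move=> a x y; apply: inj; rewrite hB lT !hB.
exists c^-1 => [|x]; first by rewrite invr_ge0 ltW.
by rewrite mulrC ler_pdivlMr// mulrC -{2}(hB x).
Qed.

(** Expresses lo I <= T <= hi I through the real quadratic form, which is directly what coercivity
    arguments consume. *)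
Definition sym_between lo hi T : Prop :=
  [/\ bounded_operator T, forall x y, rinner (T x) y = rinner x (T y) &
      forall x, lo * rnorm x ^+ 2 <= rinner (T x) x <= hi * rnorm x ^+ 2].

(** For r < lo the operator T - r is coercive, for r > hi its negative is; either way it is
    invertible. *)
Lemma spectrum_sym_between lo hi T r :
  sym_between lo hi T -> spectrum T r%:C -> lo <= r <= hi.
Proof.
move=> [bT sT hT] sp.
have bTr : bounded_operator (T - r%:C *: idfun).
  apply: bounded_operatorB => //; apply: bounded_operatorZ.
  exact: bounded_operator_id.
have sTr x y : rinner ((T - r%:C *: idfun) x) y = rinner x ((T - r%:C *: idfun) y).
  by rewrite !fctE rinnerBl rinnerBr rinnerZl rinnerZr sT.
have q x : rinner ((T - r%:C *: idfun) x) x = rinner (T x) x - r * rnorm x ^+ 2.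
  by rewrite !fctE rinnerBl rinnerZl rinnerxx.
apply/andP; split; rewrite leNgt; apply/negP => lt.
- apply: sp; apply: (@coercive_invertible _ (lo - r)) => //; first by rewrite subr_gt0.
  by move=> x; rewrite q mulrBl lerD2r; case/andP: (hT x).
- pose S := - (T - r%:C *: idfun).
  have SE x : S x = - ((T - r%:C *: idfun) x) by [].
  have bS : bounded_operator S by rewrite /S -scaleN1r; exact: bounded_operatorZ.
  have sS x y : rinner (S x) y = rinner x (S y) by rewrite !SE rinnerNl sTr -rinnerNr.
  have c0 : 0 < r - hi by rewrite subr_gt0.
  have hS x : (r - hi) * rnorm x ^+ 2 <= rinner (S x) x.
    by rewrite SE rinnerNl q mulrBl opprB lerD2l lerN2; case/andP: (hT x).
  apply: sp; have [B [bB BT TB]] := coercive_invertible bS sS c0 hS.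
  exists (- B); split.
  + by rewrite -scaleN1r; exact: bounded_operatorZ.
  + apply/funext => x; have := congr1 (fun F => F x) BT.
    rewrite -[LHS]/(B (S x)) SE linearopN//; exact: bB.1.
  + apply/funext => x; have := congr1 (fun F => F x) TB.
    rewrite -[LHS]/(S (B x)) SE -linearopN//; exact: bTr.1.
Qed.

(** The strict inequality excludes x = 0, which replaces a normalisation to unit vectors. *)
Definition approx_eigenvalue T (z : R[i]) : Prop :=
  forall c, 0 < c -> exists x, rnorm (T x - z *: x) < c * rnorm x.

(** An inverse bounded by M would give |x| <= M |T x - z x| for all x; the constant 1 / (M + 1)
    contradicts this, also when M = 0. *)
Lemma approx_eigenvalue_spectrum T (z : R[i]) : approx_eigenvalue T z -> spectrum T z.
Proof.
move=> ae [B [/bounded_operatorP[lB [M M0 hM]] BT _]].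
have M1 : 0 < M + 1 by lra.
have [|x hx] := ae (M + 1)^-1; first by rewrite invr_gt0.
have := hM ((T - z *: idfun) x); have /= -> := congr1 (fun F => F x) BT.
apply/negP; rewrite -ltNge.
have n0 : 0 < rnorm x.
  rewrite lt_neqAle rnorm_ge0 andbT eq_sym; apply/eqP => n0.
  by move: hx; rewrite n0 mulr0 ltNge rnorm_ge0.
have : (M + 1) * rnorm ((T - z *: idfun) x) < rnorm x.
  by rewrite -ltr_pdivlMl.
have := rnorm_ge0 ((T - z *: idfun) x); lra.
Qed.

End SymmetricOperators.

(** * Polynomials in a symmetric operator *)

Section PolynomialCalculus.
Context {R : realType} {H : hilbertType R}.
Implicit Types (x y : H) (r s c e M : R) (A T S : H -> H) (p q : {poly R[i]}).

(** Complex coefficients are required to split a polynomial into linear factors. *)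
Definition cpoly_op p A x : H := \sum_(i < size p) p`_i *: iter i A x.

Lemma poly_opE (p : {poly R}) A x :
  poly_op p A x = cpoly_op (map_poly (real_complex R) p) A x.
Proof.
rewrite /poly_op /cpoly_op fct_sumE size_map_poly.
by apply: eq_bigr => i _; rewrite coef_map.
Qed.

Lemma cpoly_op_widen n p A x : (size p <= n)%N ->
  cpoly_op p A x = \sum_(i < n) p`_i *: iter i A x.
Proof.
move=> pn; rewrite /cpoly_op (big_ord_widen _ (fun i => p`_i *: iter i A x) pn).
rewrite big_mkcond/=; apply: eq_bigr => i _; case: ltnP => // ?.
by rewrite nth_default// scale0r.
Qed.

Lemma cpoly_opD p q A x : cpoly_op (p + q) A x = cpoly_op p A x + cpoly_op q A x.
Proof.
rewrite !(@cpoly_op_widen (maxn (size p) (size q))) ?leq_maxl ?leq_maxr ?size_polyD//.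
by rewrite -big_split; apply: eq_bigr => i _ /=; rewrite coefD scalerDl.
Qed.

Lemma cpoly_opZ (a : R[i]) p A x : cpoly_op (a *: p) A x = a *: cpoly_op p A x.
Proof.
rewrite !(@cpoly_op_widen (size p)) ?size_scale_leq// scaler_sumr.
by apply: eq_bigr => i _ /=; rewrite coefZ scalerA.
Qed.

Lemma cpoly_opC (a : R[i]) A x : cpoly_op a%:P A x = a *: x.
Proof.
by rewrite (@cpoly_op_widen 1) ?size_polyC_leq1// big_ord1 coefC.
Qed.

Lemma cpoly_opMX p A x : cpoly_op (p * 'X) A x = cpoly_op p A (A x).
Proof.
rewrite (@cpoly_op_widen (size p).+1); last first.
  by apply: leq_trans (size_polyMleq _ _) _; rewrite size_polyX addn2.
rewrite big_ord_recl coefMX scale0r add0r /cpoly_op; apply: eq_bigr => i _.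
by rewrite coefMX -iterSr.
Qed.

Lemma cpoly_opX A x : cpoly_op 'X A x = A x.
Proof. by rewrite -['X]mul1r cpoly_opMX -polyC1 cpoly_opC scale1r. Qed.

Lemma linear_cpoly_op p A : linear A -> linear (cpoly_op p A).
Proof.
move=> lA a x y; rewrite /cpoly_op scaler_sumr -big_split; apply: eq_bigr => i _.
have -> : iter i A (a *: x + y) = a *: iter i A x + iter i A y.
  by elim: (i : nat) => //= n ->; rewrite lA.
by rewrite /= scalerDr !scalerA mulrC.
Qed.

Lemma cpoly_opM p q A x : linear A ->
  cpoly_op (p * q) A x = cpoly_op p A (cpoly_op q A x).
Proof.
move=> lA; have lp := linear_cpoly_op p lA.
elim/poly_ind: q x => [|q a IH] x.
  by rewrite mulr0 -polyC0 !cpoly_opC !scale0r linearop0.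
rewrite mulrDr mulrA !cpoly_opD !cpoly_opMX IH linearopD//; congr (_ + _).
by rewrite mulrC mul_polyC cpoly_opZ cpoly_opC linearopZ.
Qed.

Lemma cpoly_op_comp p q A : linear A ->
  cpoly_op (p \Po q) A = cpoly_op p (cpoly_op q A).
Proof.
move=> lA; elim/poly_ind: p => [|p a IH]; apply/funext => x.
  by rewrite comp_poly0 -polyC0 !cpoly_opC.
rewrite comp_polyD comp_polyM comp_polyX comp_polyC !cpoly_opD (@cpoly_opM (p \Po q))//.
by rewrite cpoly_opMX !cpoly_opC IH.
Qed.

Lemma bounded_cpoly_op p A : bounded_operator A -> bounded_operator (cpoly_op p A).
Proof.
move=> bA; elim/poly_ind: p => [|p a IH].
  rewrite (_ : cpoly_op _ _ = 0 *: idfun).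
    by apply: bounded_operatorZ; exact: bounded_operator_id.
  by apply/funext => x; rewrite -polyC0 cpoly_opC.
rewrite (_ : cpoly_op _ _ = cpoly_op p A \o A + a *: idfun).
  apply: bounded_operatorD; first exact: bounded_operator_comp.
  by apply: bounded_operatorZ; exact: bounded_operator_id.
by apply/funext => x; rewrite cpoly_opD cpoly_opMX cpoly_opC.
Qed.

Lemma bounded_poly_op (p : {poly R}) A :
  bounded_operator A -> bounded_operator (poly_op p A).
Proof.
move=> bA; have -> : poly_op p A = cpoly_op (map_poly (real_complex R) p) A.
  by apply/funext => x; rewrite poly_opE.
exact: bounded_cpoly_op.
Qed.

Lemma poly_opB (p q : {poly R}) A x :
  poly_op (p - q) A x = poly_op p A x - poly_op q A x.
Proof.
by rewrite !poly_opE rmorphB/= cpoly_opD -scaleN1r cpoly_opZ scaleN1r.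
Qed.

Lemma poly_opM (p q : {poly R}) A x : linear A ->
  poly_op (p * q) A x = poly_op p A (poly_op q A x).
Proof.
by move=> lA; rewrite !poly_opE rmorphM/= cpoly_opM.
Qed.

Lemma poly_opZ r (p : {poly R}) A x :
  poly_op (r *: p) A x = r%:C *: poly_op p A x.
Proof. by rewrite !poly_opE linearZ/= cpoly_opZ. Qed.

Lemma poly_opX A x : poly_op 'X A x = A x.
Proof.
by rewrite poly_opE map_polyX cpoly_opX.
Qed.

(** Turns polynomials in (1 - t) X + t n I, for varying t, into polynomials in the single operator
    X. *)
Lemma poly_op_affine (p : {poly R}) r s A : linear A ->
  poly_op p (r%:C *: A + s%:C *: idfun) = poly_op (p \Po (r *: 'X + s%:P)) A.
Proof.
move=> lA; apply/funext => x; rewrite !poly_opE map_comp_poly cpoly_op_comp//.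
congr (cpoly_op _ _ x); apply/funext => y.
rewrite rmorphD/= linearZ/= map_polyX map_polyC/= cpoly_opD cpoly_opZ cpoly_opC.
by rewrite cpoly_opX.
Qed.

Lemma sym_poly_op (p : {poly R}) A : linear A ->
  (forall x y, rinner (A x) y = rinner x (A y)) ->
  forall x y, rinner (poly_op p A x) y = rinner x (poly_op p A y).
Proof.
move=> lA sA; elim/poly_ind: p => [|p a IH] x y.
  have E z : poly_op 0 A z = 0 by rewrite poly_opE rmorph0 -polyC0 cpoly_opC scale0r.
  by rewrite !E [RHS]rinnerC /rinner !inner0l.
rewrite !poly_opE !rmorphD !rmorphM/= map_polyX map_polyC/= !cpoly_opD !cpoly_opC.
rewrite rinnerDl rinnerDr rinnerZl rinnerZr; congr (_ + _).
rewrite [in LHS]cpoly_opMX [in RHS]mulrC [in RHS]cpoly_opM//.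
rewrite cpoly_opX.
by rewrite -!poly_opE IH sA.
Qed.

Definition bounded_below T : Prop :=
  exists2 c, 0 < c & forall x, c * rnorm x <= rnorm (T x).

Lemma not_approx_eigenvalue T (z : R[i]) :
  ~ approx_eigenvalue T z -> bounded_below (fun x => T x - z *: x).
Proof.
move=> /existsNP[c] /not_implyP[c0 hc]; exists c => // x.
by rewrite leNgt; apply/negP => h; apply: hc; exists x.
Qed.

Lemma bounded_below_not_approx T (z : R[i]) :
  bounded_below (fun x => T x - z *: x) -> ~ approx_eigenvalue T z.
Proof. by move=> [c c0 hc] /(_ c c0)[x]; rewrite ltNge hc. Qed.

(** If no root were an approximate eigenvalue, each linear factor of q(A) would be bounded below,
    and so would their product. *)
Lemma approx_eigenvalue_root q A : linear A -> q != 0 ->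
  approx_eigenvalue (cpoly_op q A) 0 ->
  exists2 z, root q z & approx_eigenvalue A z.
Proof.
move=> lA q0 ae; apply: contrapT => nex.
apply: bounded_below_not_approx ae.
have bb z : root q z -> bounded_below (fun x => A x - z *: x).
  by move=> qz; apply: not_approx_eigenvalue => az; apply: nex; exists z.
have [s qE] := closed_field_poly_normal q.
have lc0 : lead_coef q != 0 by rewrite lead_coef_eq0.
move: (lead_coef q) lc0 qE => l l0 qE.
have sq z : z \in s -> root q z.
  by rewrite qE rootZ// root_prod_XsubC.
have [c c0 hc] : bounded_below (cpoly_op (\prod_(z <- s) ('X - z%:P)) A).
  move: sq; clear qE; elim: s => [|z s IH] sq.
    rewrite big_nil; exists 1 => // x.
    by rewrite -polyC1 cpoly_opC scale1r mul1r.
  rewrite big_cons.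
  have [c c0 hc] := IH (fun w ws => sq w (mem_behead (s := z :: s) ws)).
  have [d d0 hd] := bb z (sq z (mem_head _ _)).
  exists (d * c) => [|x]; first exact: mulr_gt0.
  rewrite cpoly_opM// cpoly_opD -[- z%:P]polyCN cpoly_opC scaleNr.
  rewrite cpoly_opX.
  by apply: le_trans (hd _); rewrite -mulrA ler_pM2l.
have n0 : 0 < complex.Re `|l|.
  by rewrite -ltcR RRe_real// normr_gt0.
exists (complex.Re `|l| * c) => [|x]; first exact: mulr_gt0.
by rewrite scale0r subr0 qE cpoly_opZ rnormZ -mulrA ler_pM2l.
Qed.

(** Since p - p(z) = g ('X - z) for some g, the same vectors serve, at the cost of a bound for
    g(A). *)
Lemma approx_eigenvalue_poly p A (z : R[i]) : bounded_operator A ->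
  approx_eigenvalue A z -> approx_eigenvalue (cpoly_op p A) p.[z].
Proof.
move=> bA ae c c0; have lA := bA.1.
have /factor_theorem[g gE] : root (p - p.[z]%:P) z.
  by rewrite /root !hornerE subrr.
have [_ [M M0 hM]] := (bounded_operatorP _).1 (bounded_cpoly_op g bA).
have M1 : 0 < M + 1 by lra.
have [|x hx] := ae (c / (M + 1)); first exact: divr_gt0.
exists x.
have -> : cpoly_op p A x - p.[z] *: x = cpoly_op g A (A x - z *: x).
  have pE : p = g * ('X - z%:P) + p.[z]%:P by rewrite -gE subrK.
  rewrite {1}pE cpoly_opD cpoly_opC addrK cpoly_opM// cpoly_opD.
  rewrite -[- z%:P]polyCN cpoly_opC scaleNr.
  by rewrite cpoly_opX.
apply: le_lt_trans (hM _) _.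
have h0 := rnorm_ge0 (A x - z *: x).
apply: (@le_lt_trans _ _ ((M + 1) * rnorm (A x - z *: x))).
  by rewrite ler_wpM2r// lerDl.
by rewrite -ltr_pdivlMl// mulrCA mulrA.
Qed.

Lemma rinner_i x y : rinner ('i%C *: x) y = - rinner x ('i%C *: y).
Proof.
rewrite [in RHS]rinnerC /rinner !innerZl [inner y x]inner_conj.
by case: (inner x y) => a b /=; rewrite !mul0r !mul1r !sub0r opprK.
Qed.

(** With z = a + ib and S = A - a symmetric, S x is orthogonal to i x for [rinner], so |S x - i b
    x|^2 = |S x|^2 + b^2 |x|^2 >= b^2 |x|^2. *)
Lemma sym_approx_eigenvalue_real A (z : R[i]) : linear A ->
  (forall x y, rinner (A x) y = rinner x (A y)) ->
  approx_eigenvalue A z -> z = (complex.Re z)%:C.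
Proof.
case: z => a b lA sA ae; rewrite /=.
have [->//|b0] := eqVneq b 0; exfalso.
apply: bounded_below_not_approx ae; exists `|b|; rewrite ?normr_gt0// => x.
pose S y := A y - a%:C *: y.
have lS : linear S.
  by move=> c u v; rewrite /S lA scalerDr opprD addrACA scalerA mulrC -scalerA -scalerBr.
have sS u v : rinner (S u) v = rinner u (S v).
  by rewrite rinnerBl rinnerBr rinnerZl rinnerZr sA.
have S0 : rinner (S x) ('i%C *: x) = 0.
  have := sS ('i%C *: x) x; rewrite linearopZ// (rinner_i (S x) x) => h.
  by have := rinnerC ('i%C *: x) (S x); rewrite -h; lra.
have -> : A x - (a +i* b) *: x = S x - b%:C *: ('i%C *: x).
  rewrite /S -addrA -opprD scalerA -scalerDl; congr (_ - _ *: _).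
  by apply/eqP; rewrite eq_complex /=; apply/andP; split; apply/eqP; ring.
have rnormi : rnorm ('i%C *: x) ^+ 2 = rnorm x ^+ 2.
  rewrite -!rinnerxx rinner_i scalerA -expr2 sqr_i scaleN1r rinnerNr opprK.
  by [].
move: (S x) S0 => w S0.
rewrite -(@ler_pXn2r _ 2)// ?nnegrE ?mulr_ge0// exprMn real_normK ?num_real//.
rewrite -(rinnerxx (_ - _)) rinnerBl !rinnerBr !rinnerZl !rinnerZr.
rewrite [rinner ('i%C *: x) w]rinnerC S0 !rinnerxx rnormi.
have := sqr_ge0 (rnorm w); rewrite expr2; lra.
Qed.

Lemma opnorm_approached T s : 0 <= s -> s < opnorm T ->
  exists x, s * rnorm x < rnorm (T x).
Proof.
move=> s0 sT; apply: contrapT => nex.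
have : opnorm T <= s.
  by apply: opnorm_le => // x; rewrite leNgt; apply/negP => h; apply: nex; exists x.
by rewrite leNgt sT.
Qed.

(** Expanding the square bounds |T^2 x - s^2 x|^2 by s^2 (s^2 |x|^2 - |T x|^2), which is small when
    x nearly attains the norm s. Working with T^2 avoids choosing between s and -s. *)
Lemma sym_sqr_approx_eigenvalue T : (exists x : H, x != 0) ->
  bounded_operator T -> (forall x y, rinner (T x) y = rinner x (T y)) ->
  approx_eigenvalue (T \o T) ((opnorm T) ^+ 2)%:C.
Proof.
move=> [x0 x0n] bT sT c c0; set s := opnorm T.
have lT := bT.1.
have key x : rnorm (T (T x) - (s ^+ 2)%:C *: x) ^+ 2 <=
    s ^+ 2 * (s ^+ 2 * rnorm x ^+ 2 - rnorm (T x) ^+ 2).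
  rewrite -!rinnerxx rinnerBl !rinnerBr !rinnerZl !rinnerZr.
  rewrite [rinner x (T (T x))]rinnerC (sT (T x) x) !rinnerxx.
  have : rnorm (T (T x)) ^+ 2 <= s ^+ 2 * rnorm (T x) ^+ 2.
    rewrite -exprMn ler_pXn2r ?nnegrE ?mulr_ge0 ?opnorm_ge0//.
    exact: rnorm_le_opnorm.
  lra.
have := opnorm_ge0 bT; rewrite -/s le_eqVlt => /predU1P[s0|s0].
  exists x0; rewrite /= -s0 expr0n/= scale0r subr0.
  have T0 x : rnorm (T x) = 0.
    apply/eqP; rewrite eq_le rnorm_ge0 andbT; apply: le_trans (rnorm_le_opnorm _ bT) _.
    by rewrite -/s -s0 mul0r.
  by rewrite T0 mulr_gt0// rnorm_gt0.
(* If |T x| > (s - d) |x|, the bound is at most 2 s^3 d |x|^2 <= c^2 |x|^2; d <= s keeps s - d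
   nonnegative. *)
pose d := Num.min s (c ^+ 2 / (2 * s ^+ 3)).
have d0 : 0 < d by rewrite /d lt_min s0/= divr_gt0 ?mulr_gt0 ?exprn_gt0.
have ds : d <= s by rewrite /d ge_min lexx.
have dc : 2 * s ^+ 3 * d <= c ^+ 2.
  by rewrite mulrC -ler_pdivlMr ?mulr_gt0 ?exprn_gt0// /d ge_min lexx orbT.
have [||x hx] := @opnorm_approached T (s - d); rewrite ?subr_ge0//.
  by rewrite -/s ltrBlDr ltrDl.
exists x; rewrite -(@ltr_pXn2r _ 2)// ?nnegrE ?mulr_ge0 ?(ltW c0)//.
apply: le_lt_trans (key x) _.
have hx2 : (s - d) ^+ 2 * rnorm x ^+ 2 < rnorm (T x) ^+ 2.
  by rewrite -exprMn ltr_pXn2r ?nnegrE ?mulr_ge0 ?subr_ge0.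
apply: (@lt_le_trans _ _ (s ^+ 2 * (s ^+ 2 * rnorm x ^+ 2 - (s - d) ^+ 2 * rnorm x ^+ 2))).
  by rewrite ltr_pM2l ?exprn_gt0// ltrD2l ltrN2.
rewrite exprMn -mulrBl mulrA ler_wpM2r ?sqr_ge0//; apply: le_trans dc.
rewrite (_ : s ^+ 2 * _ = 2 * s ^+ 3 * d - s ^+ 2 * d ^+ 2); last by ring.
by rewrite lerBlDr lerDl mulr_ge0// sqr_ge0.
Qed.

(* With s = |p(A)|, s^2 is an approximate eigenvalue of p(A)^2, so factoring
   p^2 - s^2 over the complex numbers yields a root that is an approximate
   eigenvalue of A; it is real because A is symmetric. *)
Lemma opnorm_poly_op_attained (p : {poly R}) A : (exists x : H, x != 0) ->
  bounded_operator A -> (forall x y, rinner (A x) y = rinner x (A y)) ->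
  exists2 r, approx_eigenvalue A r%:C & `|p.[r]| = opnorm (poly_op p A).
Proof.
move=> Hn bA sA; have lA := bA.1.
pose C := map_poly (real_complex R).
have key (q : {poly R}) : q ^+ 2 - (opnorm (poly_op q A) ^+ 2)%:P != 0 ->
    exists2 r, approx_eigenvalue A r%:C & `|q.[r]| = opnorm (poly_op q A).
  set s := opnorm _ => q0.
  have bq := bounded_poly_op q bA; have sq := sym_poly_op q lA sA.
  have ae := sym_sqr_approx_eigenvalue Hn bq sq.
  have [||z] := @approx_eigenvalue_root (C (q ^+ 2 - (s ^+ 2)%:P)) A lA.
  - by rewrite map_poly_eq0.
  - move=> c c0; have [x hx] := ae c c0; exists x.
    rewrite scale0r subr0 -poly_opE poly_opB expr2 poly_opM//.
    by rewrite [poly_op _%:P _ _]poly_opE map_polyC cpoly_opC.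
  move=> rz az; have zE := sym_approx_eigenvalue_real lA sA az.
  exists (complex.Re z); first by rewrite -zE.
  move: rz; rewrite zE /root horner_map/= => /eqP[]; rewrite !hornerE => /eqP.
  rewrite subr_eq0 => /eqP h.
  apply/eqP; rewrite -(@eqrXn2 _ 2)// ?opnorm_ge0// real_normK ?num_real//.
  by rewrite h.
(* When p^2 - s^2 is the zero polynomial there is nothing to factor, but any approximate eigenvalue
   works; [key] for 'X, whose square is not constant, provides one. *)
have [p0|/key//] := eqVneq (p ^+ 2 - (opnorm (poly_op p A) ^+ 2)%:P) 0.
have [|r ar _] := key 'X.
  apply/negP => /eqP/(congr1 (fun q : {poly R} => q`_2)).
  by rewrite coefB coefC coefXn/= subr0 coef0 => /eqP; rewrite oner_eq0.
exists r => //; have := congr1 (fun q : {poly R} => q.[r]) p0.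
rewrite !hornerE => /eqP; rewrite subr_eq0 => /eqP h.
apply/eqP; rewrite -(@eqrXn2 _ 2)// ?opnorm_ge0 ?real_normK ?num_real ?h//.
exact: bounded_poly_op.
Qed.

End PolynomialCalculus.

(** * Functional calculus and operator integrals *)

(** Equal cells tagged at their left ends; the mesh is at most d / 2, so that it is strictly below
    [d]. *)
Lemma exists_tagged_partition (R : realType) (d : R) : 0 < d ->
  exists s xi, tagged_partition d s xi.
Proof.
move=> d0; have [N hN] := @archi_inv_le R 1 (d / 2) ler01 (divr_gt0 d0 (ltr0Sn _ 1)).
pose x i : R := i%:R / N.+1%:R.
have N0 : 0 < N.+1%:R^-1 :> R by rewrite invr_gt0 ltr0n.
have xS i : x i.+1 = x i + N.+1%:R^-1 by rewrite /x -natr1 mulrDl mul1r.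
have sE : 0 :: [seq x i | i <- iota 1 N.+1] = [seq x i | i <- iota 0 N.+2].
  by rewrite /= /x mul0r.
exists [seq x i | i <- iota 1 N.+1], x; split.
- split.
    have -> : 0 = x 0%N by rewrite /x mul0r.
    elim: N.+1 0%N => //= k IH i; rewrite IH andbT xS.
    by rewrite ltrDl.
  rewrite (last_nth 1) sE size_map size_iota (nth_map 0%N) ?size_iota//.
  by rewrite nth_iota// add0n /x divff// pnatr_eq0.
- move=> i; rewrite size_map size_iota => iN; rewrite sE.
  rewrite !(nth_map 0%N) ?size_iota//; last exact: leqW.
  rewrite !nth_iota//; last exact: leqW.
  rewrite !add0n xS lexx lerDl (ltW N0); split => //.
  rewrite addrAC subrr add0r -[_^-1]mul1r.
  by apply: le_lt_trans (hN N (leqnn N)) _; lra.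
Qed.

Section FunctionalCalculus.
Context {R : realType} {H : hilbertType R}.
Hypothesis Hn : exists x : H, x != 0.
Implicit Types (x y : H) (r s c e M lo hi : R) (A T S : H -> H) (p q : {poly R}).
Implicit Types (f g : R -> R).

Lemma opnormD T S : bounded_operator T -> bounded_operator S ->
  opnorm (T + S) <= opnorm T + opnorm S.
Proof.
move=> bT bS; apply: opnorm_le => [|x]; first by rewrite addr_ge0 ?opnorm_ge0.
rewrite mulrDl (le_trans (rnormD _ _))// lerD// rnorm_le_opnorm//.
Qed.

Lemma opnormN T : opnorm (- T) = opnorm T.
Proof.
rewrite /opnorm; congr (sup _); rewrite eqEsubset; split=> _ [x x1 <-];
  by exists x => //; rewrite [(- T) x]/(- T x) normrN.
Qed.

Lemma opnormBC T S : opnorm (T - S) = opnorm (S - T).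
Proof. by rewrite -opnormN opprB. Qed.

Lemma opnorm_le_dist T S : bounded_operator T -> bounded_operator S ->
  opnorm T <= opnorm S + opnorm (S - T).
Proof.
move=> bT bS; rewrite opnormBC -{1}(subrK S T) addrC opnormD//.
exact: bounded_operatorB.
Qed.

Lemma opnorm_dist_triangle T1 T2 T3 : bounded_operator T1 -> bounded_operator T2 ->
  bounded_operator T3 -> opnorm (T1 - T3) <= opnorm (T1 - T2) + opnorm (T2 - T3).
Proof.
move=> b1 b2 b3; have -> : T1 - T3 = (T1 - T2) + (T2 - T3) by rewrite addrA subrK.
by apply: opnormD; exact: bounded_operatorB.
Qed.

Lemma opnorm_poly_op_le p A e : bounded_operator A ->
  (forall x y, rinner (A x) y = rinner x (A y)) ->
  (forall r, spectrum A r%:C -> `|p.[r]| <= e) -> opnorm (poly_op p A) <= e.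
Proof.
move=> bA sA hp; have [r ar <-] := opnorm_poly_op_attained p Hn bA sA.
by apply: hp; exact: approx_eigenvalue_spectrum.
Qed.

Lemma opnorm_poly_op_ge p A r : bounded_operator A ->
  approx_eigenvalue A r%:C -> `|p.[r]| <= opnorm (poly_op p A).
Proof.
move=> bA ar; apply/ler_addgt0Pr => e e0.
have [x] := approx_eigenvalue_poly (map_poly (real_complex R) p) bA ar e0.
rewrite -poly_opE horner_map /= => hx.
have h := rnorm_le_opnorm x (bounded_poly_op p bA).
have x0 : 0 < rnorm x.
  rewrite lt_neqAle rnorm_ge0 andbT eq_sym; apply/eqP => x0.
  by move: hx; rewrite x0 mulr0 ltNge rnorm_ge0.
rewrite -(ler_pM2r x0) -rnormZr mulrDl.
rewrite -(subKr (poly_op p A x) (p.[r]%:C *: x)).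
by apply: le_trans (rnormB _ _) _; rewrite lerD// ltW.
Qed.

(** [is_cfc] only provides some good polynomials q. Any other [p] close to [f] on the spectrum is
    close to q there, so p(A) is close to q(A). *)
Lemma is_cfc_approx f A T p e : bounded_operator A ->
  (forall x y, rinner (A x) y = rinner x (A y)) -> is_cfc f A T ->
  (forall r, spectrum A r%:C -> `|p.[r] - f r| <= e) ->
  opnorm (poly_op p A - T) <= e.
Proof.
move=> bA sA [bT hT] hp; apply/ler_addgt0Pr => e' e'0.
have e2 : 0 < e' / 2 by lra.
have [q [hq qT]] := hT _ e2.
apply: le_trans (opnorm_dist_triangle (bounded_poly_op p bA) (bounded_poly_op q bA) bT) _.
have : opnorm (poly_op p A - poly_op q A) <= e + e' / 2.
  have -> : poly_op p A - poly_op q A = poly_op (p - q) A.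
    by apply/funext => x; rewrite poly_opB.
  apply: opnorm_poly_op_le => // r sr; rewrite hornerD hornerN.
  rewrite (_ : _ - _ = (p.[r] - f r) - (q.[r] - f r)); last by ring.
  by apply: le_trans (ler_normB _ _) _; rewrite lerD ?hp ?hq.
lra.
Qed.

Lemma is_cfc_opnorm_le f A T e : bounded_operator A ->
  (forall x y, rinner (A x) y = rinner x (A y)) -> is_cfc f A T ->
  (forall r, spectrum A r%:C -> `|f r| <= e) -> opnorm T <= e.
Proof.
move=> bA sA [bT hT] hf; apply/ler_addgt0Pr => e' e'0.
have e2 : 0 < e' / 2 by lra.
have [q [hq qT]] := hT _ e2.
apply: le_trans (opnorm_le_dist bT (bounded_poly_op q bA)) _.
have : opnorm (poly_op q A) <= e + e' / 2.
  apply: opnorm_poly_op_le => // r sr; rewrite -(subrK (f r) q.[r]) addrC.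
  by apply: le_trans (ler_normD _ _) _; rewrite lerD ?hf ?hq.
lra.
Qed.

Lemma is_cfc_opnorm_ge f A T r : bounded_operator A ->
  is_cfc f A T -> approx_eigenvalue A r%:C -> `|f r| <= opnorm T.
Proof.
move=> bA [bT hT] ar; apply/ler_addgt0Pr => e' e'0.
have e2 : 0 < e' / 2 by lra.
have [q [hq qT]] := hT _ e2.
have := opnorm_poly_op_ge q bA ar.
have := hq r (approx_eigenvalue_spectrum ar).
have := opnorm_le_dist (bounded_poly_op q bA) bT; rewrite opnormBC.
have : `|f r| <= `|q.[r]| + `|q.[r] - f r|.
  by rewrite -{1}(subKr q.[r] (f r)) ler_normB.
lra.
Qed.

(** Completeness of the bounded operators, with an explicit rate: the limit is taken pointwise, and
    the rate, uniform on the unit ball, makes it linear and bounded. *)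
Lemma operator_limit (u : nat -> H -> H) : (forall k, bounded_operator (u k)) ->
  (forall i j x, rnorm (u i x - u j x) <= (i.+1%:R^-1 + j.+1%:R^-1) * rnorm x) ->
  exists2 T, bounded_operator T &
    forall k x, rnorm (u k x - T x) <= 2 / k.+1%:R * rnorm x.
Proof.
move=> bu hu.
have invS i j : (i <= j)%N -> j.+1%:R^-1 <= i.+1%:R^-1 :> R.
  by move=> ij; rewrite lef_pV2 ?posrE ?ltr0n// ler_nat.
have ex x : exists l, forall e, 0 < e ->
    exists N, forall i, (N <= i)%N -> rnorm (u i x - l) <= e.
  apply: cauchy_sequence_converges => e e0.
  have [N hN] := archi_inv_le (mulr_ge0 (ler0n R 2) (rnorm_ge0 x)) e0.
  exists N => i j Ni Nj; apply: le_trans (hu i j x) _; apply: le_trans (hN N _) => //.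
  rewrite mulrAC ler_wpM2r//.
  by have := invS _ _ Ni; have := invS _ _ Nj; move: (_^-1) (_^-1) (_^-1) => *; lra.
have [T hT] := choice ex.
have lim k x : rnorm (u k x - T x) <= 2 / k.+1%:R * rnorm x.
  apply/ler_addgt0Pr => e e0; have [N hN] := hT x e e0.
  pose j := maxn k N; have := hN j (leq_maxr _ _).
  rewrite (_ : u k x - T x = (u k x - u j x) + (u j x - T x)); last by rewrite addrA subrK.
  move=> h; apply: le_trans (rnormD _ _) _; apply: lerD => //.
  apply: le_trans (hu k j x) _; rewrite ler_wpM2r//.
  by have := invS _ _ (leq_maxl k N); rewrite -/j; move: (_^-1) (_^-1) => *; lra.
exists T => //.
have lT : linear T.
  move=> a x y; apply/eqP; rewrite -subr_eq0; apply/eqP.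
  pose C := rnorm (a *: x + y) + complex.Re `|a| * rnorm x + rnorm y.
  have C0 : 0 <= C by rewrite !addr_ge0// mulr_ge0// Re_norm_ge0.
  apply: (@rnorm_eps_eq0 _ _ _ C) => e e0.
  have [k hk] := archi_inv_le (ler0n R 2) e0.
  have {}hk := hk k (leqnn k).
  have lu := (bu k).1.
  have -> : T (a *: x + y) - (a *: T x + T y) =
    - (u k (a *: x + y) - T (a *: x + y)) + (a *: (u k x - T x) + (u k y - T y)).
    by rewrite lu scalerBr (addrACA (a *: u k x)) -opprD opprB addrA subrK.
  apply: le_trans (rnormD _ _) _; rewrite rnormN.
  apply: (@le_trans _ _ (2 / k.+1%:R * C)); last by rewrite ler_wpM2r.
  rewrite /C -addrA mulrDr lerD//; apply: le_trans (rnormD _ _) _.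
  by rewrite mulrDr lerD// rnormZ mulrCA ler_wpM2l// Re_norm_ge0.
apply/bounded_operatorP; split=> //.
have [_ [M M0 hM]] := (bounded_operatorP _).1 (bu 0%N).
exists (M + 2) => [|x]; first by lra.
rewrite -(subKr (u 0%N x) (T x)) (le_trans (rnormB _ _))// mulrDl lerD//.
by have := lim 0%N x; rewrite divr1.
Qed.

(** Weierstrass polynomials with error 1 / (k + 1) on [lo, hi], which contains the spectrum, give
    operators with the Cauchy rate asked for by [operator_limit]. *)
Lemma cfcP lo hi f M A : sym_between lo hi A -> lo < hi ->
  unif_cont_on lo hi f -> (forall r, lo <= r <= hi -> `|f r| <= M) ->
  is_cfc f A (cfc f A).
Proof.
move=> hA lohi cf bf; have [bA sA _] := hA.
suff ex : [set T | is_cfc f A T] !=set0 by exact: (xgetPex 0 ex).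
have k0 k : (0 : R) < k.+1%:R^-1 by rewrite invr_gt0 ltr0n.
have [p hp] := choice (fun k => weierstrass lohi cf bf (k0 k)).
have sp r : spectrum A r%:C -> lo <= r <= hi by exact: spectrum_sym_between hA.
have bp k := bounded_poly_op (p k) bA.
have [i j x|T bT hT] := operator_limit bp.
  rewrite -poly_opB.
  apply: le_trans (rnorm_le_opnorm _ (bounded_poly_op _ bA)) _.
  rewrite ler_wpM2r//; apply: opnorm_poly_op_le => // r /sp sr.
  rewrite hornerD hornerN (_ : _ - _ = ((p i).[r] - f r) - ((p j).[r] - f r)); last by ring.
  by apply: le_trans (ler_normB _ _) _; rewrite lerD// hp.
exists T; split=> // e e0.
have [k hk] := archi_inv_le (ler0n R 2) e0; have {}hk := hk k (leqnn k).
exists (p k); split=> [r /sp sr|].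
  apply: le_trans (hp k r sr) _; apply: le_trans hk.
  by rewrite ler_peMl ?ler1n// ltW.
by apply: opnorm_le => [|x]; [exact: ltW|apply: le_trans (hT k x) _; rewrite ler_wpM2r].
Qed.

(** If p is close to the square root on the spectrum of B = A^* A, then p^2 is close to the identity
    function there, so P = p(B) satisfies both P ~ T and P^2 ~ B. *)
Lemma absop_sqr A : bounded_operator A -> absop A \o absop A = adjoint A \o A.
Proof.
move=> bA; have [bB adj] := adjointP bA; set B := adjoint A \o A.
have hA x y : rinner (B x) y = rinner (A x) (A y).
  by rewrite rinnerC /rinner -adj -/(rinner _ _) rinnerC.
have bBB : bounded_operator B by exact: bounded_operator_comp.
have sB x y : rinner (B x) y = rinner x (B y) by rewrite hA rinnerC -hA rinnerC.
have [_ [M M0 hM]] := (bounded_operatorP _).1 bA.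
have hi0 : 0 < M ^+ 2 + 1 by have := sqr_ge0 M; lra.
have hB : sym_between 0 (M ^+ 2 + 1) B.
  split=> // x; rewrite hA rinnerxx mul0r sqr_ge0/= mulrDl mul1r.
  apply: le_trans (_ : M ^+ 2 * rnorm x ^+ 2 <= _); last by rewrite lerDl sqr_ge0.
  by rewrite -exprMn ler_pXn2r ?nnegrE ?mulr_ge0.
set K := Num.sqrt (M ^+ 2 + 1).
have sqrtK r : 0 <= r <= M ^+ 2 + 1 -> `|Num.sqrt r| <= K.
  by move=> /andP[r0 rhi]; rewrite ger0_norm ?sqrtr_ge0// ler_sqrt// ltW.
have K0 : 0 <= K by rewrite sqrtr_ge0.
have cT := cfcP hB hi0 (@continuous_unif_cont_on R 0 (M ^+ 2 + 1) _ (@sqrt_continuous R)) sqrtK.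
rewrite -/(absop A) in cT; have [bT hT] := cT; set T := absop A in cT bT hT *.
have sp r : spectrum B r%:C -> 0 <= r <= M ^+ 2 + 1 by exact: spectrum_sym_between hB.
apply/funext => x; apply/eqP; rewrite -subr_eq0; apply/eqP => /=.
have t0 := opnorm_ge0 bT.
(* The constant collects |T| from T (T - P), |T| + 1 from (T - P) P, and 2K + 1 from P^2 - B, where
   p^2 - r factors as a difference of squares. Taking [e1] at most 1 yields both summands 1. *)
apply: (@rnorm_eps_eq0 _ _ _ ((2 * opnorm T + 1 + 2 * K + 1) * rnorm x)) => e e0.
pose e1 := Num.min e 1.
have e10 : 0 < e1 by rewrite lt_min e0 ltr01.
have e1e : e1 <= e by rewrite ge_min lexx.
have e11 : e1 <= 1 by rewrite ge_min lexx orbT.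
have [p [hp pT]] := hT _ e10.
have bP := bounded_poly_op p bBB; set P := poly_op p B in pT bP.
have nP : opnorm P <= opnorm T + 1.
  by apply: le_trans (opnorm_le_dist bP bT) _; rewrite opnormBC; lra.
have dPT y : rnorm (P y - T y) <= e1 * rnorm y.
  apply: le_trans (rnorm_le_opnorm y (bounded_operatorB bP bT)) _.
  by rewrite ler_wpM2r.
have PB : rnorm (P (P x) - B x) <= e1 * (2 * K + 1) * rnorm x.
  have -> : P (P x) - B x = poly_op (p * p - 'X) B x.
    by rewrite poly_opB poly_opX poly_opM//; exact: bBB.1.
  apply: le_trans (rnorm_le_opnorm x (bounded_poly_op _ bBB)) _; rewrite ler_wpM2r//.
  apply: opnorm_poly_op_le => // r sr; have /andP[r0 r1] := sp r sr.
  rewrite !hornerE -{3}(sqr_sqrtr r0) -expr2 subr_sqr normrM ler_pM//; first exact: hp.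
  rewrite (_ : p.[r] + _ = (p.[r] - Num.sqrt r) + 2 * Num.sqrt r); last by ring.
  apply: le_trans (ler_normD _ _) _; rewrite addrC normrM ger0_norm// lerD//.
    by rewrite ler_wpM2l// sqrtK// r0.
  exact: le_trans (hp r sr) e11.
have -> : T (T x) - B x =
    (T (T x - P x) + (T (P x) - P (P x))) + (P (P x) - B x).
  rewrite (linearopB (T x) (P x) bT.1).
  by rewrite !subrKA.
have n1 : rnorm (T (T x - P x)) <= e1 * opnorm T * rnorm x.
  apply: le_trans (rnorm_le_opnorm _ bT) _; rewrite mulrAC mulrC ler_wpM2r//.
  by rewrite rdistC dPT.
have n2 : rnorm (T (P x) - P (P x)) <= e1 * (opnorm T + 1) * rnorm x.
  rewrite rdistC; apply: le_trans (dPT _) _; rewrite -mulrA ler_wpM2l ?(ltW e10)//.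
  by apply: le_trans (rnorm_le_opnorm _ bP) _; rewrite ler_wpM2r.
apply: le_trans (rnormD _ _) _.
apply: (@le_trans _ _ (e1 * ((2 * opnorm T + 1 + 2 * K + 1) * rnorm x))).
  by have := rnormD (T (T x - P x)) (T (P x) - P (P x)); lra.
by rewrite ler_wpM2r// mulr_ge0//; lra.
Qed.

End FunctionalCalculus.

(** * Bhatia-Kittaneh inequality and identification of the operator integral *)

Section OperatorMean.
Context {R : realType} {H : hilbertType R}.
Hypothesis Hn : exists x : H, x != 0.
Implicit Types (x y z : H) (r s c e : R) (A T S : H -> H).
Implicit Types (f g : R -> R).

Lemma poly_op_sum n (a : 'I_n -> R) (q : 'I_n -> {poly R}) A x :
  poly_op (\sum_i a i *: q i) A x = \sum_i (a i)%:C *: poly_op (q i) A x.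
Proof.
elim/big_ind2 : _ => [|p1 u1 p2 u2 <- <-|i _]; last exact: poly_opZ.
  by rewrite -(scale0r (0 : {poly R})) poly_opZ scale0r.
by rewrite !poly_opE rmorphD cpoly_opD.
Qed.

(* Bhatia-Kittaneh: for w = A^* z + D^* y one has
   |w|^2 = <A w, z> + <D w, y>, hence |w|^2 <= 2 |X| (|z|^2 + |y|^2);
   polarisation and scaling of z against y give the bound on <D^* y, A^* z>. *)
Lemma opnorm_mul_adjoint_le A D (X : H -> H) :
  bounded_operator A -> bounded_operator D -> bounded_operator X ->
  (forall x, rinner (X x) x = 2^-1 * (rnorm (A x) ^+ 2 + rnorm (D x) ^+ 2)) ->
  opnorm (A \o adjoint D) <= opnorm X.
Proof.
move=> bA bD bX hX; have [bA' adjA] := adjointP bA; have [bD' adjD] := adjointP bD.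
have {}adjA x y : rinner (A x) y = rinner x (adjoint A y) by rewrite /rinner adjA.
have {}adjD x y : rinner (D x) y = rinner x (adjoint D y) by rewrite /rinner adjD.
set m := opnorm X; have m0 : 0 <= m by exact: opnorm_ge0.
have sqr_w y z : rnorm (adjoint A z + adjoint D y) ^+ 2 <=
    2 * m * (rnorm z ^+ 2 + rnorm y ^+ 2).
  set w := adjoint A z + adjoint D y.
  have wE : rnorm w ^+ 2 = rinner (A w) z + rinner (D w) y.
    by rewrite adjA adjD -rinnerDr rinnerxx.
  have Xw : rnorm (A w) ^+ 2 + rnorm (D w) ^+ 2 <= 2 * m * rnorm w ^+ 2.
    have := rinner_le (X w) w; rewrite hX.
    have := ler_wpM2r (rnorm_ge0 w) (rnorm_le_opnorm w bX).
    rewrite /= -/m; lra.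
  (* For t >= 0 the right-hand side dominates (t |A w| - |z|)^2 + (t |D w| - |y|)^2; for t < 0 every
     term is nonnegative. The discriminant then eliminates |A w| and |D w|. *)
  have h t : 0 <= (2 * m * rnorm w ^+ 2) * t ^+ 2 + 2 * (- rnorm w ^+ 2) * t +
      (rnorm z ^+ 2 + rnorm y ^+ 2).
    have h1 := rinner_le (A w) z; have h2 := rinner_le (D w) y.
    have [t0|t0] := leP 0 t; last first.
      have := sqr_ge0 (rnorm w); have := sqr_ge0 (rnorm z); have := sqr_ge0 (rnorm y).
      have := sqr_ge0 t; nra.
    have := sqr_ge0 (t * rnorm (A w) - rnorm z).
    have := sqr_ge0 (t * rnorm (D w) - rnorm y).
    have : 0 <= t ^+ 2 * (2 * m * rnorm w ^+ 2 - (rnorm (A w) ^+ 2 + rnorm (D w) ^+ 2)).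
      by rewrite mulr_ge0 ?sqr_ge0// subr_ge0.
    have : 0 <= t * (rnorm (A w) * rnorm z + rnorm (D w) * rnorm y - rnorm w ^+ 2).
      by rewrite mulr_ge0//; lra.
    lra.
  have w2 : 0 <= 2 * m * rnorm w ^+ 2 by rewrite !mulr_ge0// sqr_ge0.
  have := discriminant_le w2 h; rewrite sqrrN.
  have [->|w0] := eqVneq (rnorm w) 0.
    by move=> _; rewrite expr0n/= mulr_ge0 ?addr_ge0 ?sqr_ge0 ?mulr_ge0.
  have {}w0 : 0 < rnorm w ^+ 2 by rewrite exprn_even_gt0.
  by move=> W2; rewrite -(ler_pM2r w0) -expr2 [leRHS]mulrAC.
have bound y z : rinner (adjoint D y) (adjoint A z) ^+ 2 <=
    (m * rnorm y ^+ 2) * (m * rnorm z ^+ 2).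
  rewrite -sqrrN; apply: discriminant_le; first by rewrite mulr_ge0 ?sqr_ge0.
  move=> t; have := sqr_w (t%:C *: y) z.
  rewrite (linearopZ _ _ bD'.1) rnormZr exprMn real_normK ?num_real//.
  have := sqr_ge0 (rnorm (adjoint A z - t%:C *: adjoint D y)).
  rewrite -!rinnerxx !(rinnerDl, rinnerDr, rinnerNl, rinnerNr, rinnerZl, rinnerZr).
  rewrite (rinnerC (adjoint A z) (adjoint D y)) !rinnerxx; lra.
apply: opnorm_le => // y; set u := adjoint D y.
(* For z = A u the inner product <D^* y, A^* z> becomes |A D^* y|^2, and one factor |A u|^2
   cancels. *)
have := bound y (A u); rewrite -/u -adjA -/(rinner _ _) rinnerxx => h.
have [->|u0] := eqVneq (rnorm (A u)) 0; first by rewrite mulr_ge0.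
have {}u0 : 0 < rnorm (A u) ^+ 2 by rewrite exprn_even_gt0.
rewrite -(@ler_pXn2r _ 2)// ?nnegrE ?mulr_ge0// exprMn -(ler_pM2r u0) -expr2.
by apply: le_trans h _; rewrite le_eqVlt; apply/orP; left; apply/eqP; ring.
Qed.

Lemma sym_between_affine (X : H -> H) (m m' n t : R) :
  sym_between 0 m X -> m <= m' -> 0 <= n <= m -> 0 <= t <= 1 ->
  sym_between 0 m' ((1 - t)%:C *: X + (t * n)%:C *: idfun).
Proof.
move=> [bX sX hX] mm' nm t01; split.
- by apply: bounded_operatorD; apply: bounded_operatorZ => //; exact: bounded_operator_id.
- move=> x y; rewrite !fctE rinnerDl rinnerDr !rinnerZl !rinnerZr.
  by rewrite sX.
- move=> x; rewrite !fctE rinnerDl !rinnerZl rinnerxx mul0r.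
  have := hX x; rewrite mul0r; have := sqr_ge0 (rnorm x).
  move: (rnorm x ^+ 2) (rinner (X x) x) => u v u0 /andP[v0 vm].
  apply/andP; split; first by rewrite addr_ge0// !mulr_ge0//; lra.
  have : (1 - t) * v <= (1 - t) * (m * u) by rewrite ler_wpM2l//; lra.
  have : t * n * u <= t * m * u by rewrite ler_wpM2r// ler_wpM2l//; lra.
  have : m * u <= m' * u by rewrite ler_wpM2r.
  lra.
Qed.

(** The norm is attained as |r| on an approximate eigenvalue r, and positivity of the operator gives
    r >= 0. *)
Lemma approx_eigenvalue_opnorm (X : H -> H) (m : R) :
  sym_between 0 m X -> approx_eigenvalue X (opnorm X)%:C.
Proof.
move=> hX; have [bX sX _] := hX.
have [r ar] := opnorm_poly_op_attained 'X Hn bX sX.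
have -> : poly_op 'X X = X by apply/funext => x; rewrite poly_opX.
have /andP[r0 _] := spectrum_sym_between hX (approx_eigenvalue_spectrum ar).
by rewrite hornerX ger0_norm// => <-.
Qed.

(** A Riemann sum finer than both moduli is close to both integrals. Its boundedness is what lets
    [opnorm] control its values at each vector. *)
Lemma op_integral_unique (a b : R) (F : R -> H -> H) T S :
  (forall d : R, 0 < d -> exists (s : seq R) (xi : nat -> R),
    [/\ itv_partition a b s,
        forall i, (i < size s)%N ->
         nth b (a :: s) i <= xi i <= nth b (a :: s) i.+1 /\
         nth b (a :: s) i.+1 - nth b (a :: s) i < d &
        bounded_operator (riemann_sum a b F s xi)]) ->
  is_op_integral a b F T -> is_op_integral a b F S -> T = S.
Proof.
move=> fine [bT hT] [bS hS]; apply/funext => x; apply/eqP; rewrite -subr_eq0; apply/eqP.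
apply: (@rnorm_eps_eq0 _ _ _ (2 * rnorm x)) => e e0.
have [d1 [d10 h1]] := hT e e0; have [d2 [d20 h2]] := hS e e0.
have [|s [xi [ps hs bR]]] := fine (Num.min d1 d2); first by rewrite lt_min d10.
have {}h1 := h1 s xi ps; have {}h2 := h2 s xi ps.
have -> : T x - S x = (riemann_sum a b F s xi - S) x - (riemann_sum a b F s xi - T) x.
  by rewrite !fctE opprB addrC subrKA addrC.
apply: le_trans (rnormB _ _) _; rewrite mulrCA mulr_natl mulr2n lerD//.
- apply: le_trans (rnorm_le_opnorm _ (bounded_operatorB bR bS)) _.
  rewrite ler_wpM2r// h2// => i /hs[? hd]; split => //.
  by apply: lt_le_trans hd _; rewrite ge_min lexx orbT.
- apply: le_trans (rnorm_le_opnorm _ (bounded_operatorB bR bT)) _.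
  rewrite ler_wpM2r// h1// => i /hs[? hd]; split => //.
  by apply: lt_le_trans hd _; rewrite ge_min lexx.
Qed.

End OperatorMean.

(* The integral is the operator g(X), where g x is the mean of f over the
   segment from x to n. *)
Lemma op_integral_cfc (R : realType) (H : hilbertType R)
    (Hn : exists x : H, x != 0) (f : R -> R) (X : H -> H) (m n : R) :
  (forall x, 0 <= x -> 0 <= f x) ->
  (forall x y, 0 <= x -> x <= y -> f x <= f y) ->
  {within `[0, +oo[, continuous f} ->
  sym_between 0 m X -> 0 <= n <= m ->
  exists2 g : R -> R,
    forall x, 0 <= x <= m -> exists2 t, 0 <= t <= 1 & g x = f ((1 - t) * x + t * n) &
    is_cfc g X (op_integral 0 1
      (fun t : R => cfc f ((1 - t)%:C *: X + (t * n)%:C *: idfun))).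
Proof.
move=> f0 fi cf hX nm; have [bX sX bdX] := hX.
set F := (fun t : R => _).
pose m1 := m + 1; have mm1 : m <= m1 by rewrite lerDl.
have m0 : 0 <= m by lra.
have m10 : 0 < m1 by rewrite /m1; lra.
have nm1 : 0 <= n <= m1 by rewrite /m1; lra.
have [g [cg gmean gint]] := segment_mean cf nm1.
have bf r : 0 <= r <= m1 -> `|f r| <= f m1.
  by move=> /andP[r0 r1]; rewrite ger0_norm ?f0 ?fi.
have bg r : 0 <= r <= m1 -> `|g r| <= f m1.
  by move=> r01; have [t t01 ->] := gmean r r01; apply: bf; exact: segment_combination_itv.
have hX1 : sym_between 0 m1 X.
  split=> // x; have /andP[h1 h2] := bdX x; rewrite h1/=; apply: le_trans h2 _.
  by rewrite ler_wpM2r// sqr_ge0.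
have cfcF t : 0 <= t <= 1 -> is_cfc f ((1 - t)%:C *: X + (t * n)%:C *: idfun) (F t).
  move=> t01; have hS := sym_between_affine hX mm1 nm t01.
  by apply: (cfcP Hn hS m10 _ bf); exact: unif_cont_on_nneg.
have cfcg := cfcP Hn hX1 m10 cg bg.
have bRS d s xi : tagged_partition d s xi -> bounded_operator (riemann_sum 0 1 F s xi).
  move=> ps; apply: bounded_operator_sum => i; apply: bounded_operatorZ.
  by have [] := cfcF (xi i) (tagged_partition_itv ps (ltn_ord i)).
have gI : is_op_integral 0 1 F (cfc g X).
  split; first exact: cfcg.1.
  move=> e e0; have e3 : 0 < e / 3 by lra.
  have [d d0 hd] := gint _ e3; exists d; split=> // s xi ps hs.
  have tp : tagged_partition d s xi by split.
  (* One polynomial for [f], composed with the affine maps of the tags and averaged, gives [r]. Then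
     r(X) is within e / 3 of the Riemann sum, and within 2e / 3 of g(X): e / 3 from p against f, e /
     3 from the scalar Riemann sums. *)
  have [p hp] := weierstrass m10 (unif_cont_on_nneg cf m1) bf e3.
  pose D i := nth 1 (0 :: s) i.+1 - nth 1 (0 :: s) i.
  have D0 (i : 'I_(size s)) : 0 <= D i.
    by have [/andP[? ?] _] := hs i (ltn_ord i); rewrite subr_ge0; apply: le_trans (_ : _ <= xi i) _.
  have DS : \sum_(i < size s) D i = 1.
    by have := sum_tagged_partition id tp; rewrite subr0.
  pose q (i : 'I_(size s)) := p \Po ((1 - xi i) *: 'X + (xi i * n)%:P).
  pose r := \sum_(i < size s) D i *: q i.
  have xi01 (i : 'I_(size s)) : 0 <= xi i <= 1 by exact: tagged_partition_itv tp (ltn_ord i).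
  have e23 : 0 <= 2 * (e / 3) by lra.
  have step1 x : rnorm (riemann_sum 0 1 F s xi x - poly_op r X x) <= e / 3 * rnorm x.
    rewrite /riemann_sum fct_sumE poly_op_sum -sumrB.
    apply: le_trans (rnorm_sum _) _.
    have -> : e / 3 * rnorm x = \sum_(i < size s) D i * (e / 3 * rnorm x).
      by rewrite -mulr_suml DS mul1r.
    apply: ler_sum => i _; rewrite !fctE -scalerBr rnormZr ger0_norm ?D0//.
    rewrite ler_wpM2l ?D0//.
    have hS := sym_between_affine hX mm1 nm (xi01 i); have [bS sS _] := hS.
    rewrite rdistC -poly_op_affine; last exact: bX.1.
    have bF := (cfcF _ (xi01 i)).1.
    apply: le_trans (rnorm_le_opnorm x (bounded_operatorB (bounded_poly_op p bS) bF)) _.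
    rewrite ler_wpM2r//; apply: (is_cfc_approx Hn bS sS (cfcF _ (xi01 i))).
    by move=> y sy; apply: hp; exact: spectrum_sym_between hS sy.
  have step2 : opnorm (poly_op r X - cfc g X) <= 2 * (e / 3).
    apply: (is_cfc_approx Hn bX sX cfcg) => y sy.
    have y01 := spectrum_sym_between hX1 sy.
    rewrite (_ : r.[y] - g y =
      \sum_(i < size s) D i * (p.[(1 - xi i) * y + xi i * n] - f ((1 - xi i) * y + xi i * n))
      + (\sum_(i < size s) D i * f ((1 - xi i) * y + xi i * n) - g y)); last first.
      rewrite addrA -big_split/=; congr (_ - _).
      rewrite /r horner_sum; apply: eq_bigr => i _.
      by rewrite hornerZ horner_comp !hornerE; ring.
    apply: le_trans (ler_normD _ _) _; rewrite mulr_natl mulr2n lerD//; last exact: hd.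
    apply: le_trans (ler_norm_sum _ _ _) _.
    have -> : e / 3 = \sum_(i < size s) D i * (e / 3) by rewrite -mulr_suml DS mul1r.
    apply: ler_sum => i _.
    rewrite normrM ger0_norm ?D0// ler_wpM2l ?D0// hp//.
    exact: segment_combination_itv.
  have br := bounded_poly_op r bX.
  apply: opnorm_le => [|x]; first exact: ltW.
  rewrite (_ : (_ - _) x = (riemann_sum 0 1 F s xi x - poly_op r X x) +
    (poly_op r X - cfc g X) x); last by rewrite !fctE addrA subrK.
  apply: le_trans (rnormD _ _) _.
  apply: (@le_trans _ _ (e / 3 * rnorm x + 2 * (e / 3) * rnorm x)); last first.
    by rewrite le_eqVlt; apply/orP; left; apply/eqP; field.
  apply: lerD => //.
  apply: le_trans (rnorm_le_opnorm x (bounded_operatorB br cfcg.1)) _.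
  by rewrite ler_wpM2r.
have ex : [set T | is_op_integral 0 1 F T] !=set0 by exists (cfc g X).
exists g.
  by move=> x xm; apply: gmean; have /andP[-> xm'] := xm; exact: le_trans mm1.
rewrite (_ : op_integral 0 1 F = cfc g X)//.
apply: (op_integral_unique _ (xgetPex 0 ex) gI) => d d0.
have [s [xi tp]] := exists_tagged_partition d0.
by exists s, xi; split; [exact: tp.1|exact: tp.2|exact: bRS tp].
Qed.

Theorem theorem3p15 (R : realType) (H : hilbertType R)
    (H_neq0 : exists x : H, x != 0)
    (A D : H -> H) (A_bounded : bounded_operator A)
    (D_bounded : bounded_operator D)
    (f : R -> R)
    (f_ge0 : forall x : R, 0 <= x -> 0 <= f x)
    (f_incr : forall x y : R, 0 <= x -> x <= y -> f x <= f y)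
    (f_opconvex : operator_convex H `[0, +oo[ f) :
  let X : H -> H :=
    (2^-1 : R)%:C *: ((absop A \o absop A) + (absop D \o absop D)) in
  let n : R := opnorm (A \o adjoint D) in
  f n <= opnorm (op_integral 0 1
           (fun t : R => cfc f ((1 - t)%:C *: X + (t * n)%:C *: idfun)))
  /\
  opnorm (op_integral 0 1
           (fun t : R => cfc f ((1 - t)%:C *: X + (t * n)%:C *: idfun)))
    <= opnorm (cfc f X).
Proof.
move=> X n.
have [f_cont _] := f_opconvex.
have XE x : X x = (2^-1 : R)%:C *: (adjoint A (A x) + adjoint D (D x)).
  by rewrite /X !absop_sqr.
have [bA' adjA] := adjointP A_bounded; have [bD' adjD] := adjointP D_bounded.
have bX : bounded_operator X.
  rewrite /X !absop_sqr//; apply: bounded_operatorZ.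
  by apply: bounded_operatorD; exact: bounded_operator_comp.
(* This form yields the symmetry of X, its positivity, and the hypothesis of
   [opnorm_mul_adjoint_le]. *)
have qX x y : rinner (X x) y = 2^-1 * (rinner (A x) (A y) + rinner (D x) (D y)).
  rewrite XE rinnerZl rinnerDl ![rinner (adjoint _ _) _]rinnerC.
  rewrite (_ : rinner y _ = rinner (A y) (A x)); last by rewrite /rinner adjA.
  rewrite (_ : rinner y _ = rinner (D y) (D x)); last by rewrite /rinner adjD.
  by rewrite (rinnerC (A y)) (rinnerC (D y)).
have qXx x : rinner (X x) x = 2^-1 * (rnorm (A x) ^+ 2 + rnorm (D x) ^+ 2).
  by rewrite qX !rinnerxx.
set m := opnorm X.
have hX : sym_between 0 m X.
  split=> // [x y|x]; first by rewrite (rinnerC x) !qX (rinnerC (A y)) (rinnerC (D y)).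
  rewrite mul0r qXx mulr_ge0 ?addr_ge0 ?sqr_ge0 ?invr_ge0//= -qXx.
  apply: le_trans (rinner_le _ _) _; rewrite expr2 mulrA ler_wpM2r//.
  exact: rnorm_le_opnorm.
have nm : 0 <= n <= m.
  rewrite opnorm_ge0/=; last exact: bounded_operator_comp.
  exact: opnorm_mul_adjoint_le.
have /andP[n0 n_le_m] := nm; have m0 : 0 <= m := le_trans n0 n_le_m.
have sX : forall x y, rinner (X x) y = rinner x (X y) by case: hX.
have am := approx_eigenvalue_opnorm H_neq0 hX; rewrite -/m in am.
have [g g_mean g_int] := op_integral_cfc H_neq0 f_ge0 f_incr f_cont hX nm.
split.
- apply: le_trans (is_cfc_opnorm_ge bX g_int am); apply: le_trans (ler_norm _).
  have [|t /andP[t0 t1] ->] := g_mean m; first by rewrite m0 lexx.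
  (* The point (1 - t) m + t n exceeds n by exactly (1 - t) (m - n). *)
  apply: f_incr => //; have : 0 <= (1 - t) * (m - n) by rewrite mulr_ge0 ?subr_ge0.
  lra.
- have m1_gt0 : 0 < m + 1 by lra.
  have hX1 : sym_between 0 (m + 1) X.
    split=> // x; have [_ _ /(_ x)/andP[-> h]] := hX; apply: le_trans h _.
    by rewrite ler_wpM2r ?sqr_ge0// lerDl.
  have bf r : 0 <= r <= m + 1 -> `|f r| <= f (m + 1).
    by move=> /andP[r0 r1]; rewrite ger0_norm ?f_ge0 ?f_incr.
  have fX := cfcP H_neq0 hX1 m1_gt0 (unif_cont_on_nneg f_cont (m + 1)) bf.
  apply: le_trans (is_cfc_opnorm_ge bX fX am); rewrite ger0_norm ?f_ge0//.
  apply: (is_cfc_opnorm_le H_neq0 bX sX g_int) => r /(spectrum_sym_between hX) r0m.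
  have [t t01 ->] := g_mean r r0m.
  have /andP[c0 cm] := segment_combination_itv nm r0m t01.
  by rewrite ger0_norm ?f_ge0 ?f_incr.
Qed.
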